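(* Let $(V,h)$ be a quadratic space of signature $(p,q)$ and let $\gamma:\mathrm{Cl}(V,h)\to\mathrm{End}_{\mathbb R}(S)$ be an irreducible real Clifford representation with $S\ne0$, with Schur algebra $\mathbb{S}$, anticommutant subspace $A$ and reduced Lipschitz group $\mathcal{L}$. The following maps from the canonical spinor group $\Lambda(V,h)$ to $\mathcal{L}$ are well-defined isomorphisms of groups: 1. If $p-q\equiv 0,2 \pmod 8$: $\Lambda(V,h)=\mathrm{Pin}(V,h)$ and $\varphi(x)=\gamma(x)$ for all $x\in\mathrm{Pin}(V,h)$. 2. If $p-q\equiv 3,7\pmod 8$: $\Lambda(V,h)=\mathrm{Spin}^o(V,h)$ and $$\varphi_{\nu,u}([x,e^{\theta e_1e_2}e_1^{\kappa}])=\gamma(x)\,e^{\theta J_\nu}\,u^\kappa,\qquad x\in\mathrm{Spin}(V,h),\ \theta\in\mathbb{R},\ \kappa\in\{0,1\},$$ where $J_\nu=\gamma(\nu)$, $\nu$ is the Clifford volume element of $(V,h)$ determined by a choice of orientation of $V$, and $u\in A$ is an element which is a basis of $A$ over $\mathbb{S}$ and satisfies $u^2=\alpha_{p,q}\mathrm{id}_S$ and $usu^{-1}=c(s)$ for all $s\in\mathbb{S}$. 3. If $p-q\equiv 4,6\pmod 8$: $\Lambda(V,h)=\mathrm{Pin}^q(V,h)$ and $\varphi_f([x,y])=\gamma(x)f(y)$ for all $x\in\mathrm{Pin}(V,h)$, $y\in\mathrm{U}(\mathbb{H})=\mathrm{Sp}(1)$, where $f:\mathbb{H}\to\mathbb{S}$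 is a unital isomorphism of normed $\mathbb{R}$-algebras. 4. If $p-q\equiv 1\pmod 8$: $\Lambda(V,h)=\mathrm{Spin}(V,h)$ and $\varphi(x)=\gamma(x)$ for all $x\in\mathrm{Spin}(V,h)$. 5. If $p-q\equiv 5\pmod 8$: $\Lambda(V,h)=\mathrm{Spin}^q(V,h)$ and $\varphi_f([x,y])=\gamma(x)f(y)$ for all $x\in\mathrm{Spin}(V,h)$, $y\in\mathrm{U}(\mathbb{H})=\mathrm{Sp}(1)$, where $f:\mathbb{H}\to\mathbb{S}$ is a unital isomorphism of normed $\mathbb{R}$-algebras.
   Context: A quadratic space $(V,h)$ is a nonzero finite-dimensional real vector space with a nondegenerate symmetric bilinear form of signature $(p,q)$ ($p$ positive, $q$ negative), $d=p+q$. $\mathrm{Cl}(V,h)$ is the real Clifford algebra with $v^2=h(v,v)$; $\mathrm{Cl}_+(V,h)$ is its even part. $\mathrm{Pin}(V,h)$ is the subgroup of $\mathrm{Cl}(V,h)^\times$ generated by vectors $v$ with $|h(v,v)|=1$, and $\mathrm{Spin}(V,h)=\mathrm{Pin}(V,h)\cap\mathrm{Cl}_+(V,h)$. The Clifford volume element of an orientation is $\nu=\epsilon_1\cdots \epsilon_d$ for an oriented orthonormal basis $(\epsilon_i)$. Real representations are unital algebra morphisms to $\mathrm{End}_{\mathbb R}(S)$, $S$ a finite-dimensional real vector space. For $\alpha\in\{-1,1\}$, $\mathrm{Pin}_2(\alpha)$ is the pin group of $\mathbb{R}^{2,0}$ if $\alpha=1$ and of $\mathbb{R}^{0,2}$ if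 $\alpha=-1$; with $e_1,e_2$ the canonical basis of $\mathbb{R}^2$, every element is of the form $e^{\theta e_1e_2}e_1^\kappa$ with $\theta\in\mathbb{R}$, $\kappa\in\{0,1\}$. For groups $G_1,G_2$ each containing a distinguished central element $-1$, $G_1\cdot G_2=(G_1\times G_2)/\{(1,1),(-1,-1)\}$. For $p-q\equiv3,7\pmod 8$ let $\alpha_{p,q}=(-1)^{\frac{p-q+1}{4}}$ and $\mathrm{Spin}^o(V,h)=\mathrm{Spin}(V,h)\cdot\mathrm{Pin}_2(\alpha_{p,q})$. Also $\mathrm{Pin}^q(V,h)=\mathrm{Pin}(V,h)\cdot\mathrm{Sp}(1)$ and $\mathrm{Spin}^q(V,h)=\mathrm{Spin}(V,h)\cdot\mathrm{Sp}(1)$. Let $W=\gamma(V)$. The Schur algebra is $\mathbb{S}=\{a\in\mathrm{End}_{\mathbb R}(S)\,|\,aw=wa\ \forall w\in W\}$ and the anticommutant subspace is $A=\{a\in\mathrm{End}_{\mathbb R}(S)\,|\,aw=-wa\ \forall w\in W\}$, a left $\mathbb{S}$-module. One has $\mathbb{S}=\mathbb{R}\,\mathrm{id}_S$ if $p-q\equiv0,1,2$; $\mathbb{S}=\mathbb{R}\,\mathrm{id}_S\oplus\mathbb{R}\gamma(\nu)\simeq\mathbb{C}$ (with $\gamma(\nu)^2=-\mathrm{id}_S$) if $p-q\equiv3,7$; $\mathbb{S}\simeq\mathbb{H}$ if $p-q\equiv4,5,6\pmod 8$. $c:\mathbb{S}\to\mathbb{S}$ is the identity if $\mathbb{S}\simeq\mathbb{R}$,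 and the canonical conjugation if $\mathbb{S}\simeq\mathbb{C},\mathbb{H}$. The Lipschitz group is $\mathrm{L}=\{a\in\mathrm{Aut}_{\mathbb R}(S)\,|\,aWa^{-1}\subset W\}$. An adapted pairing is a nondegenerate $\mathbb{R}$-bilinear form $\mathcal{B}$ on $S$ that is symmetric or skew-symmetric and for which there is a sign $\epsilon_{\mathcal B}$ (its type) with $w^t=\epsilon_{\mathcal B}w$ for all $w\in W$, where $t$ is the $\mathcal{B}$-transpose. The canonical pairing $\mathcal{B}_e$ is the adapted pairing (unique up to rescaling by a nonzero real number) such that: (a) its type is $-(-1)^{[d/2]}$ if $p-q\not\equiv1,5\pmod 8$ and $+(-1)^{[d/2]}$ if $p-q\equiv1,5\pmod 8$; (b) $s^{t}=c(s)$ for all $s\in\mathbb{S}$; (c) if $p-q\equiv3,7\pmod 8$, then $u^{t}=u^{-1}$ for $u$ as in item 2 of the claim. The canonical Lipschitz norm is $\mathcal{N}_e(a)=a^{t}a$ ($t$ the $\mathcal{B}_e$-transpose); it maps $\mathrm{L}$ to $\mathbb{R}^\times\mathrm{id}_S\simeq\mathbb{R}^\times$, and $|\mathcal{N}_e|:\mathrm{L}\to\mathbb{R}_{>0}$ is a group morphism. The reduced Lipschitz group is $\mathcal{L}=\ker|\mathcal{N}_e|$. *)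

(* Defs.v *)
From HB Require Import structures.
From mathcomp Require Import all_boot all_order all_algebra.
From mathcomp Require Import all_classical all_reals all_analysis.
From mathcomp Require Import complex.
From mathcomp Require Import ring.

Set Implicit Arguments.
Unset Strict Implicit.
Unset Printing Implicit Defensive.

Import Order.TTheory GRing.Theory Num.Theory.
Import numFieldNormedType.Exports.

Local Open Scope classical_set_scope.
Local Open Scope ring_scope.

Record quat (R : Type) := Quat { qre : R; qi : R; qj : R; qk : R }.

Section QuaternionAlgebra.
Variable R : realType.
Local Notation H := (quat R).
Implicit Types x y : H.

Definition quat_code x := (qre x, qi x, qj x, qk x).
Definition quat_decode (t : R * R * R * R) :=
  Quat t.1.1.1 t.1.1.2 t.1.2 t.2.
Lemma quat_codeK : cancel quat_code quat_decode. Proof. by case. Qed.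

HB.instance Definition _ := Choice.copy H (can_type quat_codeK).

Definition addq x y :=
  Quat (qre x + qre y) (qi x + qi y) (qj x + qj y) (qk x + qk y).
Definition oppq x := Quat (- qre x) (- qi x) (- qj x) (- qk x).
Definition scaleq (a : R) x := Quat (a * qre x) (a * qi x) (a * qj x) (a * qk x).
Definition mulq x y :=
  Quat (qre x * qre y - qi x * qi y - qj x * qj y - qk x * qk y)
       (qre x * qi y + qi x * qre y + qj x * qk y - qk x * qj y)
       (qre x * qj y - qi x * qk y + qj x * qre y + qk x * qi y)
       (qre x * qk y + qi x * qj y - qj x * qi y + qk x * qre y).

Let quat0 : H := Quat 0 0 0 0.
Let quat1 : H := Quat 1 0 0 0.

Fact addqA : associative addq.
Proof. by move=> [????] [????] [????]; congr Quat => /=; ring. Qed.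
Fact addqC : commutative addq.
Proof. by move=> [????] [????]; congr Quat => /=; ring. Qed.
Fact add0q : left_id quat0 addq.
Proof. by move=> [????]; congr Quat => /=; ring. Qed.
Fact addNq : left_inverse quat0 oppq addq.
Proof. by move=> [????]; congr Quat => /=; ring. Qed.

HB.instance Definition _ := GRing.isZmodule.Build H addqA addqC add0q addNq.

Fact mulqA : associative mulq.
Proof. by move=> [????] [????] [????]; congr Quat => /=; ring. Qed.
Fact mul1q : left_id quat1 mulq.
Proof. by move=> [????]; congr Quat => /=; ring. Qed.
Fact mulq1 : right_id quat1 mulq.
Proof. by move=> [????]; congr Quat => /=; ring. Qed.
Fact mulqDl : left_distributive mulq +%R.
Proof. by move=> [????] [????] [????]; congr Quat => /=; ring. Qed.
Fact mulqDr : right_distributive mulq +%R.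
Proof. by move=> [????] [????] [????]; congr Quat => /=; ring. Qed.
Fact quat1_neq0 : quat1 != 0.
Proof. by apply/eqP => -[] /eqP; rewrite oner_eq0. Qed.

HB.instance Definition _ :=
  GRing.Zmodule_isNzRing.Build H mulqA mul1q mulq1 mulqDl mulqDr quat1_neq0.

Fact scaleqA a b x : scaleq a (scaleq b x) = scaleq (a * b) x.
Proof. by case: x => ????; congr Quat => /=; ring. Qed.
Fact scale1q : left_id 1 scaleq.
Proof. by move=> [????]; congr Quat => /=; ring. Qed.
Fact scaleqDr : right_distributive scaleq +%R.
Proof. by move=> ? [????] [????]; congr Quat => /=; ring. Qed.
Fact scaleqDl x : {morph scaleq^~ x : a b / a + b}.
Proof. by case: x => ???? ??; congr Quat => /=; ring. Qed.

HB.instance Definition _ :=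
  GRing.Zmodule_isLmodule.Build R H scaleqA scale1q scaleqDr scaleqDl.

Fact scaleqAl (a : R) (x y : H) : a *: (x * y) = (a *: x) * y.
Proof. by case: x y => [????] [????]; congr Quat => /=; ring. Qed.
HB.instance Definition _ := GRing.Lmodule_isLalgebra.Build R H scaleqAl.

Fact scaleqAr (a : R) (x y : H) : a *: (x * y) = x * (a *: y).
Proof. by case: x y => [????] [????]; congr Quat => /=; ring. Qed.
HB.instance Definition _ := GRing.Lalgebra_isAlgebra.Build R H scaleqAr.

Definition conjq x : H := Quat (qre x) (- qi x) (- qj x) (- qk x).
Definition normq x : R :=
  Num.sqrt (qre x ^+ 2 + qi x ^+ 2 + qj x ^+ 2 + qk x ^+ 2).
Definition Sp1 : set H := [set x | normq x = 1].

End QuaternionAlgebra.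

(* Groups are represented as subsets of an ambient type carrying a            *)
(* multiplication: *%R for Cl(V,h), composition for End(S), and the setwise   *)
(* product [mulset] for quotient groups, whose elements are cosets.           *)

Definition is_group (T : Type) (mul : T -> T -> T) (one : T) (G : set T) :=
  [/\ G one,
      forall x y, G x -> G y -> G (mul x y),
      forall x y z, G x -> G y -> G z -> mul x (mul y z) = mul (mul x y) z,
      forall x, G x -> mul one x = x /\ mul x one = x &
      forall x, G x -> exists y, [/\ G y, mul x y = one & mul y x = one]].

Definition group_iso (T U : Type) (mulT : T -> T -> T) (oneT : T) (G : set T)
    (mulU : U -> U -> U) (oneU : U) (K : set U) (f : T -> U) :=
  [/\ is_group mulT oneT G, is_group mulU oneU K, set_bij G K f &
      forall x y, G x -> G y -> f (mulT x y) = mulU (f x) (f y)].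

(* X is meant to consist of units of C; the last constructor closes under     *)
(* inverses, as C need not carry an inversion.                                *)
Inductive generated (C : nzRingType) (X : set C) : C -> Prop :=
| generated_in x : X x -> generated X x
| generated_one : generated X 1
| generated_mul x y : generated X x -> generated X y -> generated X (x * y)
| generated_inv x y :
    generated X x -> x * y = 1 -> y * x = 1 -> generated X y.

Definition mulset (C : nzRingType) (X Y : set C) : set C :=
  [set z | exists x y, [/\ X x, Y y & z = x * y]].

(* The coset of z in C modulo {1,-1}.  In the ring C1 * C2 one has 1 = (1,1)  *)
(* and -1 = (-1,-1).                                                          *)
Definition pmcoset (C : nzRingType) (z : C) : set C := [set z; - z].

(* G1 . G2 = (G1 x G2) / {(1,1), (-1,-1)} *)
Definition dotgroup (C1 C2 : nzRingType) (G1 : set C1) (G2 : set C2)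
    : set (set (C1 * C2)) :=
  [set pmcoset z | z in G1 `*` G2].

(* y is the sum of the exponential series of x.  In finite dimension,         *)
(* convergence is the same as convergence against all linear forms.  The      *)
(* multiplication is a parameter because 'End(S) has no canonical ring        *)
(* structure.                                                                 *)
Definition is_exp (R : realType) (A : lmodType R) (mul : A -> A -> A)
    (one x y : A) :=
  forall l : {scalar A},
    series (fun k => l ((k`!%:R)^-1 *: iter k (mul x) one)) n
      @[n --> \oo] --> (l y : R^o).

Definition expA (R : realType) (A : lmodType R) (mul : A -> A -> A)
    (one x : A) : A :=
  xget 0 [set y | is_exp mul one x y].

Section CliffordAlgebra.
Variables (R : realType) (V : vectType R).

Record is_clifford_algebra (h : V -> V -> R) (C : algType R)
    (iota : {linear V -> C}) : Prop := {
  clifford_sqr : forall v, iota v * iota v = (h v v)%:A ;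
  clifford_univ : forall (B : algType R) (f : {linear V -> B}),
    (forall v, f v * f v = (h v v)%:A) ->
    exists2 g : {lrmorphism C -> B}, (forall v, g (iota v) = f v) &
      forall g' : {lrmorphism C -> B},
        (forall v, g' (iota v) = f v) -> g' =1 g }.

Variables (h : V -> V -> R) (C : algType R) (iota : {linear V -> C}).

Definition Pin : set C :=
  generated [set iota v | v in [set v | `|h v v| = 1]].

Definition clifford_even : set C :=
  [set x | exists s : seq (R * seq V),
     all (fun t => ~~ odd (size t.2)) s /\
     x = \sum_(t <- s) t.1 *: \prod_(v <- t.2) iota v].

Definition Spin : set C := Pin `&` clifford_even.

Definition orthonormal_basis n (e : n.-tuple V) :=
  [/\ basis_of fullv e,
      forall i j : 'I_n, i != j -> h (tnth e i) (tnth e j) = 0 &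
      forall i, `|h (tnth e i) (tnth e i)| = 1].

Definition signature (p q : nat) :=
  exists e : (p + q).-tuple V,
    [/\ orthonormal_basis e,
        #|[set i | 0 < h (tnth e i) (tnth e i)]%SET| = p &
        #|[set i | h (tnth e i) (tnth e i) < 0]%SET| = q].

(* The volume element of the orientation determined by e; every orientation   *)
(* is determined by some orthonormal basis.                                   *)
Definition volume n (e : n.-tuple V) : C := \prod_(i < n) iota (tnth e i).

End CliffordAlgebra.

Definition quadratic_space (R : realType) (V : vectType R)
    (h : {symmetric V}) (p q : nat) :=
  [/\ (0 < p + q)%N, nondegenerate h & signature h p q].

Definition residue (p q : nat) : int := ((p%:Z - q%:Z) %% 8)%Z.

Definition alpha (R : realType) (p q : nat) : R :=
  (-1) ^ ((p%:Z - q%:Z + 1) %/ 4)%Z.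

(* For a = 1 (resp. a = -1), R^2 with this form is R^{2,0} (resp. R^{0,2}). *)
Definition form2 (R : realType) (a : R) (u v : 'rV[R]_2) : R :=
  a * (u 0 0 * v 0 0 + u 0 1 * v 0 1).

Section Representation.
Variables (R : realType) (V : vectType R) (h : {symmetric V}) (p q : nat).
Variables (C : algType R) (iota : {linear V -> C}).
Variables (S : vectType R) (gamma : {linear C -> 'End(S)}).

Definition irreducible_representation :=
  [/\ gamma 1 = \1%VF,
      forall x y, gamma (x * y) = (gamma x \o gamma y)%VF,
      fullv != 0%VS :> {vspace S} &
      forall U : {vspace S}, (forall x, (gamma x @: U <= U)%VS) ->
        U = 0%VS \/ U = fullv].

Definition clifford_image : set 'End(S) := range (gamma \o iota).

Definition schur_algebra : set 'End(S) :=
  [set a | forall w, clifford_image w -> (a \o w)%VF = (w \o a)%VF].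

Definition anticommutant : set 'End(S) :=
  [set a | forall w, clifford_image w -> (a \o w)%VF = - (w \o a)%VF].

Definition schur_iso (K : lalgType R) (f : {linear K -> 'End(S)}) :=
  [/\ f 1 = \1%VF,
      forall x y, f (x * y) = (f x \o f y)%VF &
      set_bij setT schur_algebra f].

(* The conjugation of K in {R, C, H} is transported to the Schur algebra.     *)
(* Automorphisms of the real algebra K commute with the conjugation, so the   *)
(* choice of f is immaterial.                                                 *)
Definition schur_conjugation (c : 'End(S) -> 'End(S)) :=
  [\/ exists2 f : {linear R^o -> 'End(S)},
        schur_iso f & forall x, c (f x) = f x,
      exists2 f : {linear Rcomplex R -> 'End(S)},
        schur_iso f & forall x, c (f x) = f (conjc x) |
      exists2 f : {linear quat R -> 'End(S)},
        schur_iso f & forall x, c (f x) = f (conjq x)].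

Variable c : 'End(S) -> 'End(S).

(* the norm |s| of s in the Schur algebra is defined by |s|^2 id_S = c(s) s *)
Definition normed_schur_iso (f : {linear quat R -> 'End(S)}) :=
  schur_iso f /\
  forall x, (c (f x) \o f x)%VF = normq x ^+ 2 *: (\1%VF : 'End(S)).

Definition anticommutant_basis (u : 'End(S)) :=
  [/\ anticommutant u,
      forall a, anticommutant a ->
        exists! s, schur_algebra s /\ a = (s \o u)%VF,
      (u \o u)%VF = alpha R p q *: (\1%VF : 'End(S)) &
      forall s, schur_algebra s -> (u \o s \o u^-1)%VF = c s].

Definition lipschitz_group : set 'End(S) :=
  [set a | lker a == 0%VS /\
     forall w, clifford_image w -> clifford_image (a \o w \o a^-1)%VF].

Section Pairing.
Variables (eps : bool) (B : {hermitian S for eps & idfun}).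

Definition is_transpose (a a' : 'End(S)) :=
  forall x y, B (a x) y = B x (a' y).

(* B is symmetric for eps = false and skew-symmetric for eps = true *)
Definition adapted_pairing (e : bool) :=
  nondegenerate B /\
  forall w, clifford_image w -> is_transpose w ((-1) ^+ e *: w).

(* the type is (-1) ^+ canonical_type *)
Definition canonical_type : bool :=
  odd (p + q)./2 (+) (residue p q \notin ([:: 1; 5] : seq int)).

Definition canonical_pairing :=
  [/\ adapted_pairing canonical_type,
      forall s, schur_algebra s -> is_transpose s (c s) &
      residue p q \in ([:: 3; 7] : seq int) ->
        forall u, anticommutant_basis u -> is_transpose u (u^-1)%VF].

(* r is the canonical Lipschitz norm of a *)
Definition reduced_lipschitz_group : set 'End(S) :=
  [set a | lipschitz_group a /\
     exists b r, [/\ is_transpose a b,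
       (b \o a)%VF = r *: (\1%VF : 'End(S)) & `|r| = 1]].

End Pairing.
End Representation.

(* Main.v *)
Require Import Defs.
From HB Require Import structures.
From mathcomp Require Import all_boot all_order all_algebra.
From mathcomp Require Import all_classical all_reals all_analysis.
From mathcomp Require Import complex.
From mathcomp Require Import ring lra zify.

Set Implicit Arguments.
Unset Strict Implicit.
Unset Printing Implicit Defensive.

Import Order.TTheory GRing.Theory Num.Theory.
Import numFieldNormedType.Exports.

Local Open Scope classical_set_scope.
Local Open Scope ring_scope.

(** The group of reduced Lipschitz elements is computed by splitting each of
    its elements into a spinorial part and a part that is seen by the Schur
    algebra.

    An element [a] of the Lipschitz group conjugates [gamma v] into
    [gamma (f v)], and the anticommutator of two vectors forces [f] to preserve
    [h].  By Cartan and Dieudonne ([cartan_dieudonne]) [f] is a product of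
    reflections in unit vectors, and a reflection is implemented up to sign by
    conjugation with the corresponding vector.  So [a = gamma x s] with [x] a
    product of [k] unit vectors and [s] commuting with [gamma V] if [k] is
    even, anticommuting with it if [k] is odd ([reduced_factor]).

    - If [d] is even, the volume element anticommutes with every vector;
      multiplying [x] by it makes [s] commute, so [x] is any element of Pin.
    - If [d] is odd, the volume element [nu] is central.  When [nu^2 = 1],
      irreducibility gives [gamma nu = 1] or [gamma nu = -1], which excludes
      anticommuting [s]; so [x] is in Spin.  When [nu^2 = -1], multiplying by
      [nu] turns an odd [x] into an even one, and the anticommuting [s] are the
      multiples of [u] by the Schur algebra.

    The remaining [s] lies in the Schur algebra, where the condition on the
    Lipschitz norm says that [s] has norm one: [s] is a sign, a rotation
    [cos t + sin t gamma nu], or a unit quaternion.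

    Conversely, if [x] is an even product of unit vectors (or any product when
    [d] is even) and [gamma x] commutes with all vectors, then [x] is [1] or
    [-1] ([word_kernel]); this gives the kernels.  The argument takes place in
    the Clifford algebra, where an even element that commutes with an
    orthonormal basis is a scalar ([graded_span_central]).

    The type of the Schur algebra is read off as follows.  In the quaternionic
    cases it is part of the data [f].  For [p - q = 3, 7] it contains
    [gamma nu], whose square is [-1], and conjugation by [u] realises [c]; as
    [c] is then multiplicative, the quaternions are excluded.  For
    [p - q = 0, 1, 2] one has to exclude both the complex numbers and the
    quaternions, and this is the theorem of Frobenius and Schur for the finite
    group of signed products of basis vectors.  Writing [m] for the number of
    square roots of [-1] in the standard basis of the Schur algebra, the sum of
    the traces of the squares of these products has the sign of [1 - m]
    ([frobenius_schur]), whereas the sum of the squares is the real part of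
    [(1 + i) (1 - i)^p (1 + i)^q], which is positive
    ([sum_basis_words], [powers_Re_gt0]).

    For [p - q = 3, 7], the assignment [e1 -> u], [e1 e2 -> gamma nu] extends
    to an injective representation [rho] of the plane Clifford algebra
    ([plane_rep_exists], [rho_inj]), and the isomorphism is
    [(x, y) -> gamma x rho y].  Its value at the exponential of a multiple of
    [e1 e2] is computed from the series of cosine and sine; injectivity of
    [rho] also provides the linear forms that make this exponential unique. *)

(** * Words in vectors, Pin and Spin *)

Lemma normr1_sqr (R : realType) (a : R) : `|a| = 1 -> a * a = 1.
Proof. by move=> a1; rewrite -expr2 -real_normK ?num_real// a1 expr1n. Qed.

Lemma sqr1_normr (R : realType) (a : R) : a * a = 1 -> `|a| = 1.
Proof.
move=> aa; have : `|a| ^+ 2 = 1 by rewrite real_normK ?num_real // expr2.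
by move/eqP; rewrite sqrp_eq1 // => /eqP.
Qed.

Lemma signr_pred (R : realType) n : (0 < n)%N -> (-1) ^+ n.-1 = - (-1) ^+ n :> R.
Proof. by case: n => // n _; rewrite exprS mulN1r opprK. Qed.

Lemma signr_odd_eq (R : realType) n : odd n -> (-1) ^+ n = -1 :> R.
Proof. by move=> on; rewrite -signr_odd on. Qed.

Lemma signr_even_eq (R : realType) n : ~~ odd n -> (-1) ^+ n = 1 :> R.
Proof. by move=> en; rewrite -signr_odd (negbTE en). Qed.

Lemma scalar_inj (R : realType) (A : algType R) : injective (fun a : R => a%:A : A).
Proof.
move=> a b /eqP; rewrite -subr_eq0 -scalerBl scaler_eq0 oner_eq0 orbF subr_eq0.
by move/eqP.
Qed.

Lemma scalarM (R : realType) (A : algType R) (a b : R) :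
  (a%:A : A) * b%:A = (a * b)%:A.
Proof. by rewrite -scalerAl mul1r scalerA. Qed.

Section CliffordWords.
Variables (R : realType) (V : vectType R) (h : V -> V -> R).
Variables (C : algType R) (iota : {linear V -> C}).
Hypothesis hC : is_clifford_algebra h iota.

Definition word (vs : seq V) : C := \prod_(v <- vs) iota v.
Definition unit_vectors (vs : seq V) := forall v, v \in vs -> `|h v v| = 1.

Lemma word_nil : word [::] = 1. Proof. exact: big_nil. Qed.
Lemma word_cons v vs : word (v :: vs) = iota v * word vs.
Proof. exact: big_cons. Qed.
Lemma word_cat us vs : word (us ++ vs) = word us * word vs.
Proof. exact: big_cat. Qed.
Lemma word_seq1 v : word [:: v] = iota v.
Proof. exact: big_seq1. Qed.

Lemma unit_vectors_cat us vs :
  unit_vectors us -> unit_vectors vs -> unit_vectors (us ++ vs).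
Proof. by move=> hu hv v; rewrite mem_cat => /orP[/hu|/hv]. Qed.

Lemma clifford_sqrZ (a : R) v : h (a *: v) (a *: v) = a ^+ 2 * h v v.
Proof.
apply: (@scalar_inj R C); rewrite -(clifford_sqr hC) linearZ /=.
by rewrite -scalerAl -scalerAr (clifford_sqr hC) !scalerA expr2.
Qed.

(** For a unit vector [v] the square of [iota v] is [h v v], which is [1] or
    [-1], so [iota v] is inverted by [h v v *: v]. *)
Definition inverse_word (vs : seq V) := rev [seq h v v *: v | v <- vs].

Lemma inverse_word_unit vs : unit_vectors vs -> unit_vectors (inverse_word vs).
Proof.
move=> hvs w; rewrite mem_rev => /mapP[v /hvs v1 ->].
by rewrite clifford_sqrZ normrM normrX v1 expr1n mulr1.
Qed.

Lemma word_inverse vs : unit_vectors vs ->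
  word vs * word (inverse_word vs) = 1 /\ word (inverse_word vs) * word vs = 1.
Proof.
elim: vs => [|v vs IH] hvs; first by rewrite /inverse_word /= word_nil mul1r.
have [IH1 IH2] := IH (fun w hw => hvs w (mem_behead (s := v :: vs) hw)).
have v1 : h v v * h v v = 1 by apply/normr1_sqr/hvs/mem_head.
rewrite /inverse_word /= rev_cons -cats1 word_cat -/(inverse_word vs).
rewrite word_seq1 word_cons linearZ /= -!scalerAr; split.
  rewrite mulrA -(mulrA (iota v)) IH1 mulr1 (clifford_sqr hC) scalerA.
  by rewrite v1 scale1r.
rewrite -scalerAl mulrA -(mulrA (word _)) (clifford_sqr hC) -scalerAr -scalerAl.
by rewrite mulr1 IH2 scalerA v1 scale1r.
Qed.

(** Inverses of unit vectors are unit vectors again, so closing under inverses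
    adds nothing to the products. *)
Lemma PinP x :
  Pin h iota x <-> exists2 vs, unit_vectors vs & x = word vs.
Proof.
split=> [|[vs hvs ->]].
  elim=> {x} [_ [v v1 <-]||x y _ [us hus ->] _ [vs hvs ->]|x y _ [vs hvs ->] xy _].
  - by exists [:: v]; rewrite ?word_seq1// => w; rewrite inE => /eqP ->.
  - by exists [::]; rewrite ?word_nil.
  - by exists (us ++ vs); rewrite ?word_cat//; apply: unit_vectors_cat.
  exists (inverse_word vs); first exact: inverse_word_unit.
  have [_ e] := word_inverse hvs.
  by rewrite -[LHS]mul1r -e -mulrA xy mulr1.
elim: vs hvs => [|v vs IH] hvs; first by rewrite word_nil; exact: generated_one.
rewrite word_cons; apply: generated_mul.
  by apply: generated_in; exists v => //=; apply/hvs/mem_head.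
by apply: IH => w hw; apply/hvs/mem_behead.
Qed.

Lemma Pin_inverse x : Pin h iota x ->
  exists y, [/\ Pin h iota y, x * y = 1 & y * x = 1].
Proof.
move=> /PinP[vs hvs ->]; exists (word (inverse_word vs)).
have [] := word_inverse hvs; split=> //; apply/PinP; exists (inverse_word vs) => //.
exact: inverse_word_unit.
Qed.

Lemma Pin_group : is_group *%R 1 (Pin h iota).
Proof.
split=> [|x y|x y z _ _ _|x _|x] //; first exact: generated_one.
- exact: generated_mul.
- by rewrite mulrA.
- by rewrite mul1r mulr1.
exact: Pin_inverse.
Qed.

(** The map [v -> - v] respects the Clifford relation; the universal property
    extends it to the grading involution. *)
Lemma clifford_involution :
  exists g : {lrmorphism C -> C}, forall v, g (iota v) = - iota v.
Proof.
pose f : V -> C := fun v => - iota v.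
have fL : linear f by move=> a u v; rewrite /f linearP opprD scalerN.
pose F : {linear V -> C} := HB.pack f (GRing.isLinear.Build R V C *:%R f fL).
have [v|g hg _] := clifford_univ hC (f := F).
  by rewrite /= /f mulrNN (clifford_sqr hC).
by exists g.
Qed.

Lemma involution_word (g : {lrmorphism C -> C}) vs :
  (forall v, g (iota v) = - iota v) ->
  g (word vs) = (-1) ^+ odd (size vs) *: word vs.
Proof.
move=> hg; elim: vs => [|v vs IH]; first by rewrite word_nil rmorph1 scale1r.
rewrite word_cons rmorphM /= IH hg -scalerAr mulNr.
by case: (odd _); rewrite /= ?expr1 ?expr0 ?scale1r ?scaleNr ?scale1r ?opprK.
Qed.

(** An odd product of unit vectors is negated by the grading involution, and an
    even element is fixed by it.  Both together would make twice a unit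
    vanish. *)
Lemma SpinP x :
  Spin h iota x <->
  exists vs, [/\ unit_vectors vs, ~~ odd (size vs) & x = word vs].
Proof.
split=> [[/PinP[vs hvs ->] [s [hs e]]]|[vs [hvs ev ->]]]; last first.
  split; first by apply/PinP; exists vs.
  by exists [:: (1, vs)]; rewrite /= ev big_seq1 scale1r.
exists vs; split=> //; apply/negP => ov.
have [g hg] := clifford_involution.
have g1 : g (word vs) = - word vs.
  by rewrite (involution_word _ hg) ov expr1 scaleN1r.
have g2 : g (word vs) = word vs.
  rewrite e linear_sum; apply: eq_big_seq => t /(allP hs) /negbTE et.
  by rewrite linearZ /= -/(word t.2) (involution_word _ hg) et scale1r.
have [y [_ xy _]] : exists y, [/\ Pin h iota y, word vs * y = 1 & y * word vs = 1].
  by apply: Pin_inverse; apply/PinP; exists vs.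
have : word vs *+ 2 = 0 by rewrite mulr2n -{2}g2 g1 subrr.
move=> /(congr1 (fun z => z * y)); rewrite mulrnAl xy mul0r => /eqP.
by rewrite -scaler_nat scaler_eq0 oner_eq0 pnatr_eq0.
Qed.

Lemma Spin_mul x y : Spin h iota x -> Spin h iota y -> Spin h iota (x * y).
Proof.
move=> /SpinP[us [hus eus ->]] /SpinP[vs [hvs evs ->]]; apply/SpinP.
exists (us ++ vs); rewrite word_cat size_cat oddD; split=> //.
  exact: unit_vectors_cat.
by rewrite (negbTE eus) (negbTE evs).
Qed.

Lemma Spin_group : is_group *%R 1 (Spin h iota).
Proof.
split=> [|x y|x y z _ _ _|x _|x] //.
- by apply/SpinP; exists [::]; rewrite word_nil.
- exact: Spin_mul.
- by rewrite mulrA.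
- by rewrite mul1r mulr1.
move=> /SpinP[vs [hvs ev ->]]; exists (word (inverse_word vs)).
have [] := word_inverse hvs; split=> //; apply/SpinP; exists (inverse_word vs).
by rewrite size_rev size_map; split=> //; apply: inverse_word_unit.
Qed.

End CliffordWords.

(** * Generation of the Clifford algebra by vectors *)

Section WordSpan.
Variables (R : realType) (V : vectType R) (C : algType R).
Variable (iota : {linear V -> C}).

Definition in_word_span (x : C) :=
  exists s : seq (R * seq V), x = \sum_(t <- s) t.1 *: word iota t.2.

Definition word_span : {pred C} := fun x => `[< in_word_span x >].

Fact word_span_closed : GRing.subsemialg_closed word_span.
Proof.
split.
- by apply/asboolP; exists [:: (1, [::])]; rewrite big_seq1 scale1r word_nil.
- split=> [|x y /asboolP[s ->] /asboolP[t ->]]; apply/asboolP.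
    by exists [::]; rewrite big_nil.
  by exists (s ++ t); rewrite big_cat.
- move=> a x /asboolP[s ->]; apply/asboolP.
  exists [seq (a * t.1, t.2) | t <- s].
  by rewrite big_map scaler_sumr; apply: eq_bigr => t _; rewrite scalerA.
move=> x y /asboolP[s ->] /asboolP[t ->]; apply/asboolP.
exists [seq (u.1 * v.1, u.2 ++ v.2) | u <- s, v <- t].
rewrite big_allpairs_dep mulr_suml; apply: eq_bigr => u _.
rewrite mulr_sumr; apply: eq_bigr => v _ /=.
by rewrite word_cat -scalerAl -scalerAr scalerA.
Qed.

(** The span of the words, made into an algebra of its own so that the
    universal property can be applied with it as the target. *)
Definition word_subalgebra := {x : C | x \in word_span}.
HB.instance Definition _ := SubChoice.on word_subalgebra.
HB.instance Definition _ := GRing.SubChoice_isSubAlgebra.Build R C word_span word_subalgebra word_span_closed.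

Lemma word_span_gen v : iota v \in word_span.
Proof.
by apply/asboolP; exists [:: (1, [:: v])]; rewrite big_seq1 scale1r word_seq1.
Qed.

Definition word_gen (v : V) : word_subalgebra := exist _ (iota v) (word_span_gen v).

Fact word_gen_linear : linear word_gen.
Proof. by move=> a u v; apply: val_inj; rewrite /= linearP. Qed.
HB.instance Definition _ :=
  GRing.isLinear.Build R V word_subalgebra *:%R word_gen word_gen_linear.

End WordSpan.

(** The universal map into the subalgebra spanned by the words, followed by the
    inclusion, agrees with the identity on vectors; by uniqueness it is the
    identity. *)
Lemma clifford_word_span (R : realType) (V : vectType R) (h : V -> V -> R)
    (C : algType R) (iota : {linear V -> C}) :
  is_clifford_algebra h iota -> forall x, in_word_span iota x.
Proof.
move=> hC x.
have [v|g hg _] := clifford_univ hC (f := word_gen iota : {linear V -> _}).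
  apply: val_inj. rewrite /= (clifford_sqr hC) //.
have [k _ uniq_k] := clifford_univ hC (f := iota) (clifford_sqr hC).
pose f y := sval (g y).
have fL : linear f by move=> a u v; rewrite /f linearP.
have fM : monoid_morphism f by split=> [|u v]; rewrite /f ?rmorph1 ?rmorphM.
pose G : {lrmorphism C -> C} := HB.pack f
  (GRing.isLinear.Build R C C *:%R f fL) (GRing.isMonoidMorphism.Build C C f fM).
have -> : x = G x.
  rewrite (uniq_k G) => [|v]; last by rewrite /= /f hg.
  exact: (uniq_k idfun).
exact/asboolP/(valP (g x)).
Qed.

(** * Anticommuting families *)

Section AnticommutingFamilies.
Variables (R : realType) (A : algType R).
Implicit Types (es : seq (R * A)) (x y : A).

(** A family is a list of pairs, a generator preceded by its square, so that the
    signs survive when the generators are mapped to another algebra. *)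
Fixpoint clifford_family es : Prop :=
  if es is f :: es' then
    [/\ `|f.1| = 1, f.2 * f.2 = f.1%:A,
        forall g, g \in es' -> g.2 * f.2 = - (f.2 * g.2) & clifford_family es']
  else True.

Lemma clifford_family_sqr es f : clifford_family es -> f \in es ->
  [/\ `|f.1| = 1 & f.2 * f.2 = f.1%:A].
Proof.
elim: es => //= g es IH [g1 gg _ hes]; rewrite inE => /orP[/eqP->//|].
exact: IH.
Qed.

(** The even ([b = false]) or odd ([b = true]) part of the subalgebra generated
    by the family, written as polynomials of degree at most one in the first
    generator with coefficients in the span of the others. *)
Fixpoint graded_span es (b : bool) x : Prop :=
  if es is f :: es' then
    exists y z, [/\ graded_span es' b y, graded_span es' (~~ b) z &
                    x = y + z * f.2]
  else if b then x = 0 else exists c : R, x = c%:A.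

Lemma graded_span0 es b : graded_span es b 0.
Proof.
elim: es b => [[]//|f es IH b] /=; first by exists 0; rewrite scale0r.
by exists 0, 0; rewrite mul0r addr0.
Qed.

Lemma graded_span1 es : graded_span es false 1.
Proof.
elim: es => [|f es IH] /=; first by exists 1; rewrite scale1r.
by exists 1, 0; rewrite mul0r addr0; split=> //; apply: graded_span0.
Qed.

Lemma graded_spanD es b x y :
  graded_span es b x -> graded_span es b y -> graded_span es b (x + y).
Proof.
elim: es b x y => [[] x y|f es IH b x y] /=.
- by move=> -> ->; rewrite addr0.
- by move=> [c ->] [d ->]; exists (c + d); rewrite scalerDl.
move=> [x1 [x2 [h1 h2 ->]]] [y1 [y2 [k1 k2 ->]]].
exists (x1 + y1), (x2 + y2); rewrite mulrDl addrACA; split=> //; exact: IH.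
Qed.

Lemma graded_spanZ es b (a : R) x :
  graded_span es b x -> graded_span es b (a *: x).
Proof.
elim: es b x => [[] x|f es IH b x] /=.
- by move=> ->; rewrite scaler0.
- by move=> [c ->]; exists (a * c); rewrite scalerA.
move=> [x1 [x2 [h1 h2 ->]]].
exists (a *: x1), (a *: x2); rewrite -scalerAl scalerDr; split=> //; exact: IH.
Qed.

Lemma graded_span_sum (I : Type) (r : seq I) es b (F : I -> A) :
  (forall i, graded_span es b (F i)) -> graded_span es b (\sum_(i <- r) F i).
Proof.
move=> hF; elim/big_ind: _ => //; first exact: graded_span0.
exact: graded_spanD.
Qed.

Lemma graded_span_comm es b x (e : A) :
  (forall g, g \in es -> g.2 * e = - (e * g.2)) -> graded_span es b x ->
  x * e = (-1) ^+ b *: (e * x).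
Proof.
elim: es b x => [[] x _|f es IH b x he] /=.
- by move=> ->; rewrite mul0r mulr0 scaler0.
- by move=> [c ->]; rewrite scale1r -scalerAl -scalerAr mul1r mulr1.
have he' g : g \in es -> g.2 * e = - (e * g.2).
  by move=> hg; apply: he; rewrite inE hg orbT.
move=> [y [z [hy hz ->]]]; rewrite mulrDl mulrDr scalerDr (IH _ _ he' hy).
rewrite -mulrA (he f (mem_head _ _)) mulrN (mulrA z e) (IH _ _ he' hz).
rewrite -scalerAl -scaleNr -mulrA; congr (_ + _ *: _).
by case: (b); rewrite /= ?expr0 ?expr1 ?opprK.
Qed.

Lemma graded_span_mul es b x f :
  clifford_family es -> f \in es -> graded_span es b x ->
  graded_span es (~~ b) (x * f.2).
Proof.
elim: es b x => //= g es IH b x [g1 gg ges hes] + [y [z [hy hz ->]]].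
rewrite inE => /orP[/eqP->|fes].
  exists (g.1 *: z), y; split=> //; first exact: graded_spanZ.
    by rewrite negbK.
  by rewrite mulrDl -mulrA gg -scalerAr mulr1 addrC.
exists (y * f.2), (- z * f.2); split; first exact: IH.
  by apply: IH => //; rewrite -scaleN1r; apply: graded_spanZ.
by rewrite mulrDl -!mulrA (ges f fes) mulrN mulNr opprK.
Qed.

(** Write [x = y + z e] with [y] even and [z] odd in the other generators.  Then
    [y] commutes with [e] and [z] anticommutes with it, so commuting with [e]
    forces [z = 0]; the remaining [y] involves one generator less. *)
Lemma graded_span_central es x : clifford_family es ->
  graded_span es false x -> (forall f, f \in es -> x * f.2 = f.2 * x) ->
  exists c : R, x = c%:A.
Proof.
elim: es x => [//|f es IH x] /= [f1 ff fes hes] [y [z [hy hz ex]]] hx.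
have hyf : y * f.2 = f.2 * y.
  by rewrite (graded_span_comm fes hy) expr0 scale1r.
have hzf : z * f.2 = - (f.2 * z).
  by rewrite (graded_span_comm fes hz) expr1 scaleN1r.
have f0 : f.1 != 0 by rewrite -normr_eq0 f1 oner_eq0.
have z0 : z = 0.
  have /eqP := hx f (mem_head _ _).
  rewrite ex mulrDl mulrDr hyf (inj_eq (addrI _)) [f.2 * _]mulrA.
  rewrite -[f.2 * z]opprK -hzf mulNr -subr_eq0 opprK -mulr2n -mulrA ff.
  by rewrite -scalerAr mulr1 -scaler_nat scalerA scaler_eq0 mulf_eq0 pnatr_eq0
     (negbTE f0) => /eqP.
apply: IH => //; first by rewrite ex z0 mul0r addr0.
by move=> g ges; apply: hx; rewrite inE ges orbT.
Qed.

Definition family_volume es : A := \prod_(f <- es) f.2.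

Lemma family_volume_anti es (e : A) :
  (forall g, g \in es -> g.2 * e = - (e * g.2)) ->
  family_volume es * e = (-1) ^+ size es *: (e * family_volume es).
Proof.
rewrite /family_volume; elim: es => [|g es IH] he.
  by rewrite big_nil mul1r mulr1 scale1r.
rewrite big_cons -mulrA IH => [|k hk]; last by apply: he; rewrite inE hk orbT.
rewrite -scalerAr (mulrA g.2 e) (he g (mem_head _ _)) mulNr scalerN -scaleNr -mulrA.
by rewrite /= exprS mulN1r.
Qed.

(** A generator anticommutes with all the factors of the volume but itself. *)
Lemma family_volume_comm es f : clifford_family es -> f \in es ->
  family_volume es * f.2 = (-1) ^+ (size es).-1 *: (f.2 * family_volume es).
Proof.
rewrite /family_volume; elim: es => //= g es IH [g1 gg ges hes].
rewrite inE big_cons => /orP[/eqP->|fes].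
  by rewrite -mulrA (family_volume_anti ges) -scalerAr.
rewrite -mulrA IH // -scalerAr (mulrA g.2 f.2) (mulrA f.2 g.2) (ges f fes).
rewrite mulNr scalerN -scaleNr; congr (_ *: _).
by case: (es) fes => // k r _; rewrite exprS mulN1r opprK.
Qed.

Lemma family_volume_sqr es : clifford_family es ->
  family_volume es * family_volume es =
  ((-1) ^+ 'C(size es, 2) * \prod_(f <- es) f.1)%:A.
Proof.
rewrite /family_volume; elim: es => [|g es IH] /=.
  by rewrite !big_nil mul1r mulr1 scale1r.
move=> [g1 gg ges hes]; rewrite !big_cons binS bin1.
rewrite mulrA -(mulrA g.2) (family_volume_anti ges) -scalerAr -scalerAl.
rewrite mulrA gg -!scalerAl mul1r IH // !scalerA exprD.
by congr (_ *: _); ring.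
Qed.

End AnticommutingFamilies.

(** * Basis words and averaging *)

Section BasisWords.
Variables (R : realType) (A : algType R).
Implicit Types (es : seq (R * A)) (x y T : A).

(** The products of the subfamilies; each word is listed with the parity of its
    length and with its square, which is [1] or [-1]. *)
Fixpoint basis_words es : seq (bool * R * A) :=
  if es is f :: es' then
    let ws := basis_words es' in
    ws ++ [seq (~~ t.1.1, (-1) ^+ t.1.1 * t.1.2 * f.1, t.2 * f.2) | t <- ws]
  else [:: (false, 1, 1)].

Lemma basis_words_comm es (e : A) t :
  (forall g, g \in es -> g.2 * e = - (e * g.2)) -> t \in basis_words es ->
  t.2 * e = (-1) ^+ t.1.1 *: (e * t.2).
Proof.
elim: es t => [|f es IH] t he /=.
  by rewrite inE => /eqP-> /=; rewrite mul1r mulr1 scale1r.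
have he' g : g \in es -> g.2 * e = - (e * g.2).
  by move=> hg; apply: he; rewrite inE hg orbT.
rewrite mem_cat => /orP[/(IH _ he')//|/mapP[s /(IH _ he') hs ->]] /=.
rewrite -mulrA (he f (mem_head _ _)) mulrN (mulrA s.2 e) hs.
rewrite -scalerAl -scaleNr -mulrA; congr (_ *: _).
by case: (s.1.1); rewrite /= ?expr0 ?expr1 ?opprK.
Qed.

Lemma basis_words_sqr es t : clifford_family es -> t \in basis_words es ->
  `|t.1.2| = 1 /\ t.2 * t.2 = t.1.2%:A.
Proof.
elim: es t => [|f es IH] t /=.
  by rewrite inE => _ /eqP-> /=; rewrite mulr1 scale1r normr1.
move=> [f1 ff fes hes].
rewrite mem_cat => /orP[|/mapP[s ts ->]] /=; first exact: IH.
have [s1 ss] := IH _ hes ts; split.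
  by rewrite !normrM s1 f1 normr_sign !mulr1.
have sf := basis_words_comm fes ts.
have fs : f.2 * s.2 = (-1) ^+ s.1.1 *: (s.2 * f.2).
  by rewrite sf scalerA -expr2 sqrr_sign scale1r.
rewrite mulrA -(mulrA s.2) fs -scalerAr -scalerAl mulrA ss -(mulrA _ f.2) ff.
by rewrite scalarM scalerA mulrA.
Qed.

(** Up to the factor [2 ^ size es] this is the average of [T] over conjugation
    by the group of signed basis words ([average_sum]).  The recursive form
    makes it evident that the generators commute with the result. *)
Fixpoint average es T : A :=
  if es is f :: es' then
    let T' := average es' T in T' + f.1 *: (f.2 * T' * f.2)
  else T.

Lemma average_sum es T : clifford_family es ->
  average es T = \sum_(t <- basis_words es) t.1.2 *: (t.2 * T * t.2).
Proof.
elim: es => [|f es IH] /=; first by rewrite big_seq1 scale1r mulr1 mul1r.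
move=> [f1 ff fes hes]; rewrite IH // big_cat big_map /=; congr (_ + _).
rewrite mulr_sumr mulr_suml scaler_sumr; apply: eq_big_seq => t /= ht.
have fs : f.2 * t.2 = (-1) ^+ t.1.1 *: (t.2 * f.2).
  by rewrite (basis_words_comm fes ht) scalerA -expr2 sqrr_sign scale1r.
rewrite -scalerAr -scalerAl !mulrA fs -!scalerAl !scalerA; congr (_ *: _).
by rewrite -[RHS]/((-1) ^+ t.1.1 * t.1.2 * f.1); ring.
Qed.

Lemma average_comm es T f : clifford_family es -> f \in es ->
  average es T * f.2 = f.2 * average es T.
Proof.
elim: es => //= g es IH [g1 gg ges hes]; rewrite inE => /orP[/eqP->|fes].
  have g1' : g.1 * g.1 = 1 by apply: normr1_sqr.
  rewrite mulrDl mulrDr addrC; congr (_ + _).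
    rewrite -scalerAl -(mulrA _ g.2 g.2) gg -scalerAr mulr1.
    by rewrite scalerA g1' scale1r.
  rewrite -scalerAr !(mulrA g.2) gg -!scalerAl mul1r.
  by rewrite scalerA g1' scale1r.
rewrite mulrDl mulrDr IH // -scalerAl -scalerAr; congr (_ + _ *: _).
have gf : g.2 * f.2 = - (f.2 * g.2) by rewrite ges // opprK.
rewrite -(mulrA _ g.2 f.2) gf mulrN (mulrA _ f.2 g.2) -(mulrA g.2 _ f.2) IH //.
by rewrite (mulrA g.2 f.2) gf !mulNr opprK !mulrA.
Qed.

(** Appending a generator with square [s] to a word of parity [b] multiplies the
    square of the word by [(-1) ^ b s].  The sum of the squares and the sum of
    the squares weighted by parity, taken as real and imaginary part, are thus
    multiplied by [1 - i s] for each generator. *)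
Lemma sum_basis_words es :
  (forall f, f \in es -> `|f.1| = 1) ->
  Complex (\sum_(t <- basis_words es) t.1.2)
          (\sum_(t <- basis_words es) (-1) ^+ t.1.1 * t.1.2)
  = Complex 1 1 * Complex 1 (-1) ^+ count (fun f => 0 < f.1) es
                * Complex 1 1 ^+ count (fun f => f.1 < 0) es.
Proof.
elim: es => [|f es IH] hes.
  by rewrite /= !big_seq1 /= !expr0 mul1r !mulr1.
have f1 : `|f.1| = 1 by apply/hes/mem_head.
have {}IH := IH (fun g hg => hes g (mem_behead (s := f :: es) hg)).
set a := \sum_(t <- basis_words es) t.1.2 in IH.
set b := \sum_(t <- basis_words es) (-1) ^+ t.1.1 * t.1.2 in IH.
have -> : Complex (\sum_(t <- basis_words (f :: es)) t.1.2)
    (\sum_(t <- basis_words (f :: es)) (-1) ^+ t.1.1 * t.1.2)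
    = Complex a b * Complex 1 (- f.1).
  rewrite /= !big_cat !big_map /= -/a -/b; apply/eqP; rewrite eq_complex /=.
  apply/andP; split; apply/eqP.
    by rewrite -mulr_suml -/b; ring.
  have -> : \sum_(t <- basis_words es)
      ((-1) ^+ (~~ t.1.1) * ((-1) ^+ t.1.1 * t.1.2 * f.1)) = - f.1 * a.
    rewrite mulr_sumr; apply: eq_bigr => t _.
    by case: (t.1.1); rewrite /= ?expr0 ?expr1; ring.
  by ring.
rewrite IH /=.
have [f0|f0|f0] := ltgtP 0 f.1.
- have -> : f.1 = 1 by rewrite -f1 gtr0_norm.
  by rewrite add0n add1n exprS; ring.
- have -> : f.1 = -1 by rewrite -f1 ltr0_norm ?opprK.
  by rewrite add0n add1n exprS opprK; ring.
by move: f1; rewrite -f0 normr0 => /eqP; rewrite eq_sym oner_eq0.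
Qed.

End BasisWords.

(** * Arithmetic of the signature modulo eight *)

Lemma residue_split (p q k : nat) : residue p q = k%:Z ->
  exists n, (p = q + k + 8 * n)%N \/ (p + 8 * n = q + k)%N.
Proof.
rewrite /residue => e; have := divz_eq (p%:Z - q%:Z) 8; rewrite e.
case: (divz _ _) => n en; [exists n; left | exists n.+1; right]; lia.
Qed.

Lemma odd_bin2 n : odd 'C(n, 2) = odd n./2.
Proof.
have [m] := ubnP n; elim: m n => // m IH [|[|n]] // hn.
by rewrite !binS !bin1 bin0 !oddD IH /= ?uphalf_half; [lia|lia].
Qed.

Lemma residue_parity p q k : residue p q = k%:Z -> odd (p + q) = odd k.
Proof. by case/residue_split => n []; lia. Qed.

Lemma volume_sign (R : realType) p q k : residue p q = k%:Z -> odd k ->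
  (-1) ^+ 'C(p + q, 2) * (-1) ^+ q = (-1) ^+ k./2 :> R.
Proof.
move=> h ok; rewrite -exprD -signr_odd -[RHS]signr_odd oddD odd_bin2.
congr (_ ^+ nat_of_bool _).
by case/residue_split: h => n []; lia.
Qed.

Section ComplexPowers.
Variable R : realType.
Local Notation w := (Complex 1 (-1) : R[i]).
Local Notation z := (Complex 1 1 : R[i]).

Lemma Re_real_mul (a : R) (c : R[i]) : complex.Re (a%:C%C * c) = a * complex.Re c.
Proof. by case: c => x y /=; ring. Qed.

(** The product of [1 + i] and [1 - i] is [2] and [(1 - i) ^ 8 = 16], so up to a
    positive factor the number depends on [p - q] modulo eight only, and for
    [p - q = k] it is [(1 + i) (1 - i) ^ k]. *)
Lemma powers_Re_gt0 p q k : residue p q = k%:Z -> (k < 3)%N ->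
  0 < complex.Re (z * w ^+ p * z ^+ q).
Proof.
have wz : w * z = 2%:C%C by apply/eqP; rewrite eq_complex /=; apply/andP; split; apply/eqP; ring.
have w2 : w ^+ 2 = Complex 0 (-2).
  by apply/eqP; rewrite expr2 eq_complex /=; apply/andP; split; apply/eqP; ring.
have w8 : w ^+ 8 = 16%:C%C.
  rewrite (exprM w 2 4) w2 !exprS expr0; apply/eqP; rewrite eq_complex /=.
  by apply/andP; split; apply/eqP; ring.
have w8m m : w ^+ (8 * m) = (16 ^+ m)%:C%C by rewrite exprM w8 -rmorphXn.
have key n : z * w ^+ (q + n) * z ^+ q = (2 ^+ q)%:C%C * (z * w ^+ n).
  by rewrite exprD rmorphXn /= -wz exprMn; ring.
move=> h k3.
have zwk : 0 < complex.Re (z * w ^+ k).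
  case: k k3 {h} => [|[|[|//]]] _; rewrite ?expr0 ?expr1 ?w2 /=; lra.
have pos m : 0 < complex.Re (z * w ^+ (q + (k + 8 * m)) * z ^+ q).
  rewrite key exprD w8m Re_real_mul (mulrA z).
  by rewrite (mulrC (z * _)) Re_real_mul !mulr_gt0 ?exprn_gt0.
have [n [->|e]] := residue_split h; first by rewrite -addnA.
have := pos 0; rewrite muln0 addn0 -e exprD w8m.
by rewrite (mulrA z) -mulrA (mulrC _ (z ^+ q)) mulrA mulrC Re_real_mul
  pmulr_rgt0 ?exprn_gt0.
Qed.
End ComplexPowers.

(** * The trace identity of Frobenius and Schur *)

Section InvariantForm.
Variables (R : realType) (n : nat).
Implicit Types (M N A T : 'M[R]_n) (Ms : seq 'M[R]_n).

(** The Gram matrix of the standard scalar product summed over all products of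
    the matrices.  Each generator that squares to a sign permutes the summands,
    so the scalar product is invariant. *)
Fixpoint invariant_form Ms : 'M[R]_n :=
  if Ms is M :: Ms' then
    let A := invariant_form Ms' in A + M *m A *m M^T
  else 1%:M.

(** Commutation up to sign is what the generators of the Clifford algebra and
    the units of the Schur algebra have in common. *)
Fixpoint sign_commuting Ms : Prop :=
  if Ms is M :: Ms' then
    [/\ exists b : bool, M *m M = ((-1) ^+ b)%:M,
        forall N, N \in Ms' -> exists b : bool, N *m M = (-1) ^+ b *: (M *m N) &
        sign_commuting Ms']
  else True.

Lemma invariant_form_sym Ms : (invariant_form Ms)^T = invariant_form Ms.
Proof.
elim: Ms => [|M Ms IH] /=; first by rewrite trmx1.
by rewrite linearD /= !trmx_mul trmxK IH mulmxA.
Qed.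

Lemma sign_cancel (b : bool) M A : ((-1) ^+ b *: M) *m A *m ((-1) ^+ b *: M)^T
  = M *m A *m M^T.
Proof.
rewrite linearZ /= -!scalemxAl -!scalemxAr scalerA -expr2.
by rewrite sqrr_sign scale1r.
Qed.

Lemma invariant_formP Ms M : sign_commuting Ms -> M \in Ms ->
  M *m invariant_form Ms *m M^T = invariant_form Ms.
Proof.
elim: Ms => //= N Ms IH [[b NN] NMs hMs]; rewrite inE => /orP[/eqP->|hM].
  rewrite mulmxDr mulmxDl addrC; congr (_ + _).
  have -> : N *m (N *m invariant_form Ms *m N^T) *m N^T =
    (N *m N) *m invariant_form Ms *m (N *m N)^T by rewrite trmx_mul !mulmxA.
  by rewrite NN -scalemx1 sign_cancel trmx1 mul1mx mulmx1.
rewrite mulmxDr mulmxDl IH //; congr (_ + _).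
have -> : M *m (N *m invariant_form Ms *m N^T) *m M^T =
    (M *m N) *m invariant_form Ms *m (M *m N)^T by rewrite trmx_mul !mulmxA.
have [c ->] := NMs M hM; rewrite sign_cancel trmx_mul.
by rewrite -!mulmxA (mulmxA M) (mulmxA (M *m _)) IH.
Qed.

Lemma invariant_form_gt0 Ms (v : 'rV[R]_n) : v != 0 ->
  0 < (v *m invariant_form Ms *m v^T) 0 0.
Proof.
have norm_ge0 (u : 'rV[R]_n) : 0 <= (u *m u^T) 0 0.
  by rewrite mxE; apply: sumr_ge0 => i _; rewrite mxE -expr2 sqr_ge0.
have norm_gt0 (u : 'rV[R]_n) : u != 0 -> 0 < (u *m u^T) 0 0.
  move=> u0; rewrite lt_neqAle norm_ge0 andbT eq_sym; apply: contra u0 => /eqP.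
  rewrite mxE => e; apply/eqP/rowP => i; rewrite mxE.
  have/psumr_eq0P := e => /(_ _ i isT); rewrite mxE -expr2.
  by move=> h; apply/eqP; rewrite -sqrf_eq0; apply/eqP/h => j _; rewrite mxE -expr2 sqr_ge0.
have ge0 Ms' (u : 'rV[R]_n) : 0 <= (u *m invariant_form Ms' *m u^T) 0 0.
  elim: Ms' u => [|M Ms' IH] u /=; first by rewrite mulmx1.
  rewrite mulmxDr mulmxDl mxE addr_ge0 // !mulmxA.
  by rewrite -(mulmxA _ M^T) -trmx_mul.
elim: Ms => [|M Ms IH] v0 /=; first by rewrite mulmx1 norm_gt0.
rewrite mulmxDr mulmxDl mxE ltr_wpDr ?IH // !mulmxA.
by rewrite -(mulmxA _ M^T) -trmx_mul.
Qed.

Lemma invariant_form_unit Ms : invariant_form Ms \in unitmx.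
Proof.
rewrite -row_free_unit; apply/inj_row_free => v vA.
apply/eqP/negPn/negP => /(invariant_form_gt0 Ms).
by rewrite vA mul0mx mxE ltxx.
Qed.

Lemma mxtrace_trmul A T : \tr (A^T *m T) = \sum_i \sum_j A i j * T i j.
Proof.
rewrite exchange_big; apply: eq_bigr => j _; rewrite mxE.
by apply: eq_bigr => i _; rewrite mxE.
Qed.

Lemma delta_sandwich M N i j k l :
  (M *m delta_mx i j *m N) k l = M k i * N j l.
Proof.
rewrite mxE (bigD1 j) //= mxE (bigD1 i) //= mxE !eqxx mulr1.
rewrite !big1 ?addr0 // => u ui.
  rewrite mxE big1 ?mul0r // => x _; rewrite mxE (negbTE ui) andbF mulr0 //.
by rewrite mxE (negbTE ui) mulr0.
Qed.

Lemma mxtrace_delta M i j : \tr (M *m delta_mx i j) = M j i.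
Proof.
rewrite -[M *m _]mulmx1 /mxtrace (bigD1 j) //= delta_sandwich mxE eqxx mulr1.
rewrite big1 ?addr0 // => k kj.
by rewrite delta_sandwich mxE eq_sym (negbTE kj) mulr0.
Qed.

(** An isometry of [A] whose square is the sign [s] has inverse [s *: M], which
    expresses its transpose without an inverse of [M]. *)
Lemma invariant_trmx A M (s : R) : A \in unitmx -> s * s = 1 ->
  M *m M = s%:M -> M *m A *m M^T = A -> M^T = s *: (invmx A *m M *m A).
Proof.
move=> uA ss MM MA; rewrite -{2}MA !mulmxA -(mulmxA _ M M) MM mul_mx_scalar.
by rewrite -!scalemxAl scalerA ss scale1r mulVmx // mul1mx.
Qed.

Lemma mxtrace_skew A M : A \in unitmx -> M *m M = -1%:M ->
  M *m A *m M^T = A -> \tr M = 0.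
Proof.
move=> uA MM MA; have MM' : M *m M = (-1)%:M by rewrite MM raddfN.
have NN1 : -1 * -1 = 1 :> R by rewrite mulrNN mulr1.
have/(congr1 mxtrace) := invariant_trmx uA NN1 MM' MA.
rewrite mxtrace_tr mxtraceZ mxtrace_mulC mulmxA mulmxV // mul1mx mulN1r.
by move/eqP; rewrite -subr_eq0 opprK -mulr2n mulrn_eq0 => /= /eqP.
Qed.

(** The hypothesis on sums expresses that averaging over the group lands in the
    span of the [d k].  The trace form determines its coefficients ([P_E]): up to
    the factor [size ws / n] they are the traces of [T] against the inverses of
    the [d k].  Applying this to elementary matrices and contracting the indices
    with the invariant form [A] turns the sum of averages into the sum of the
    traces of the squares of the group elements on one side and of the [d k] on
    the other. *)
Lemma frobenius_schur (m : nat) (ws : seq (R * 'M[R]_n)) (A : 'M[R]_n)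
    (d : 'I_m -> 'M[R]_n) (e : 'I_m -> R) :
  (0 < n)%N -> A \in unitmx -> A^T = A ->
  (forall t, t \in ws ->
     [/\ t.1 * t.1 = 1, t.2 *m t.2 = t.1%:M & t.2 *m A *m t.2^T = A]) ->
  (forall k, [/\ e k * e k = 1, d k *m d k = (e k)%:M,
     d k *m A *m (d k)^T = A &
     forall l, l != k -> \tr (d k *m d l) = 0]) ->
  (forall k t, t \in ws -> d k *m t.2 = t.2 *m d k) ->
  (forall T, exists c : 'I_m -> R,
     \sum_(t <- ws) t.1 *: (t.2 *m T *m t.2) = \sum_k c k *: d k) ->
  n%:R * \sum_(t <- ws) t.1 = (size ws)%:R * \sum_k e k.
Proof.
move=> n0 uA symA hws hd dw hP.
have nR : n%:R != 0 :> R by rewrite pnatr_eq0 -lt0n.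
have P_E T : \sum_(t <- ws) t.1 *: (t.2 *m T *m t.2) =
    \sum_k ((size ws)%:R / n%:R * \tr ((e k *: d k) *m T)) *: d k.
  have [c ec] := hP T; rewrite ec; apply: eq_bigr => k _; congr (_ *: _).
  have [ek dk _ tk] := hd k.
  have : \tr ((e k *: d k) *m \sum_(t <- ws) t.1 *: (t.2 *m T *m t.2)) =
         (size ws)%:R * \tr ((e k *: d k) *m T).
    rewrite mulmx_sumr raddf_sum /=.
    transitivity (\sum_(t <- ws) \tr ((e k *: d k) *m T)); last first.
      by rewrite big_const_seq count_predT iter_addr_0 mulr_natl.
    apply: eq_big_seq => t tws; have [ss ww _] := hws t tws.
    rewrite -scalemxAr -!scalemxAl !mxtraceZ !mulmxA dw // -!mulmxA.
    rewrite mxtrace_mulC !mulmxA -mulmxA ww mul_mx_scalar mxtraceZ.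
    by rewrite mulrCA [t.1 * (t.1 * _)]mulrA ss mul1r.
  rewrite ec mulmx_sumr raddf_sum (bigD1 k) //= big1 => [|l lk]; last first.
    by rewrite -scalemxAr -scalemxAl !mxtraceZ tk // !mulr0.
  rewrite -scalemxAr -!scalemxAl !mxtraceZ dk mxtrace_scalar addr0.
  move=> h; apply: (mulIf nR); rewrite mulrAC divfK // -h.
  by rewrite -[e k *+ n]mulr_natr (mulrA (e k)) ek mul1r.
have -> : n%:R * \sum_(t <- ws) t.1 = \sum_(t <- ws) \tr (t.2 *m t.2).
  rewrite mulr_sumr; apply: eq_big_seq => t /hws[_ -> _].
  by rewrite mxtrace_scalar mulr_natl.
have -> : \sum_(t <- ws) \tr (t.2 *m t.2) = \sum_i \sum_j
    ((\sum_(t <- ws) t.1 *: (t.2 *m (delta_mx i j *m invmx A) *m t.2)) *m A) j i.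
  transitivity (\sum_(t <- ws) \sum_i \sum_j
      t.1 * (t.2 *m delta_mx i j *m (invmx A *m t.2 *m A)) j i).
    apply: eq_big_seq => t tws; have [ss ww wA] := hws t tws.
    rewrite -{1}[t.2]trmxK mxtrace_trmul; apply: eq_bigr => i _.
    apply: eq_bigr => j _; rewrite delta_sandwich mxE.
    rewrite -[t.2 in X in _ * X]trmxK (invariant_trmx uA ss ww wA) !mxE.
    by rewrite mulrCA.
  rewrite exchange_big; apply: eq_bigr => i _.
  rewrite exchange_big; apply: eq_bigr => j _.
  rewrite mulmx_suml summxE; apply: eq_bigr => t _.
  by rewrite -scalemxAl [RHS]mxE !mulmxA.
rewrite mulr_sumr.
transitivity (\sum_i \sum_j \sum_k ((size ws)%:R / n%:R * e k) *
    ((invmx A *m d k) j i * (d k *m A) j i)).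
  apply: eq_bigr => i _; apply: eq_bigr => j _.
  rewrite P_E mulmx_suml summxE; apply: eq_bigr => k _.
  rewrite -!scalemxAl mxtraceZ [LHS]mxE -!mulrA; do 3!congr (_ * _).
  by rewrite mulmxA mxtrace_mulC mulmxA mxtrace_delta.
under eq_bigr do rewrite exchange_big /=.
rewrite exchange_big /=; apply: eq_bigr => k _.
have [ek dk dA _] := hd k.
under eq_bigr do rewrite -mulr_sumr /=.
rewrite -mulr_sumr exchange_big /= -mxtrace_trmul trmx_mul trmx_inv symA.
rewrite (invariant_trmx uA ek dk dA) !mulmxA -!scalemxAl mxtraceZ.
rewrite mulmxK // -mulmxA mxtrace_mulC mulmxA mulmxK // dk mxtrace_scalar -[e k *+ n]mulr_natr.
by rewrite (mulrA (e k)) ek mul1r mulrAC divfK.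
Qed.
End InvariantForm.

(** * Isometries as products of reflections *)

Section Isometries.
Variables (R : realType) (V : vectType R) (h : {symmetric V}).

Lemma formC u v : h u v = h v u.
Proof. by rewrite hermC expr0 mul1r. Qed.
Lemma formDl u v w : h (u + v) w = h u w + h v w. Proof. exact: linearDl. Qed.
Lemma formDr u v w : h w (u + v) = h w u + h w v. Proof. exact: linearDr. Qed.
Lemma formZr a u w : h w (a *: u) = a * h w u. Proof. exact: linearZr. Qed.
Lemma formZl a u w : h (a *: u) w = a * h u w.
Proof. by rewrite formC formZr formC. Qed.
Lemma formNr u w : h w (- u) = - h w u. Proof. exact: linearNr. Qed.
Lemma formNl u w : h (- u) w = - h u w. Proof. exact: linearNl. Qed.

(** The reflection in the hyperplane orthogonal to [v], for a unit vector [v]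
    only: [h v v] stands for its own inverse. *)
Definition reflect_in (v w : V) := w - (2 * h v w * h v v) *: v.
Definition reflections vs w := foldr reflect_in w vs.

Definition isometry (g : V -> V) := forall v w, h (g v) (g w) = h v w.

Lemma reflect_in_isometry v : `|h v v| = 1 -> isometry (reflect_in v).
Proof.
move=> /normr1_sqr v1 x y; rewrite /reflect_in.
rewrite !(formDl, formDr, formNl, formNr, formZl, formZr) (formC x v).
set a := h v x; set b := h v y; set c := h v v in v1 *.
transitivity (h x y + 4 * a * b * c * (c * c - 1)); first by ring.
by rewrite v1; ring.
Qed.

Lemma reflect_inK v : `|h v v| = 1 -> involutive (reflect_in v).
Proof.
move=> /normr1_sqr v1 x; rewrite /reflect_in formDr formNr formZr.
rewrite -addrA -opprD -scalerDl.
rewrite (_ : _ + _ = 4 * h v x * h v v * (1 - h v v * h v v)); last by ring.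
by rewrite v1 subrr mulr0 scale0r subr0.
Qed.

Lemma reflect_in_orth v w : h v w = 0 -> reflect_in v w = w.
Proof. by move=> vw; rewrite /reflect_in vw mulr0 mul0r scale0r subr0. Qed.

Lemma normalize_vector x : h x x != 0 ->
  exists v, [/\ `|h v v| = 1, exists a, v = a *: x &
    forall w, reflect_in v w = w - (2 * h x w / h x x) *: x].
Proof.
move=> x0; set s := Num.sqrt `|h x x|.
have s0 : s != 0 by rewrite sqrtr_eq0 -ltNge normr_gt0.
have ss : s ^+ 2 = `|h x x| by rewrite sqr_sqrtr.
have sV : s^-1 * s^-1 = `|h x x|^-1 by rewrite -invfM -expr2 ss.
have xx : `|h x x| * `|h x x| = h x x * h x x by rewrite -!expr2 real_normK ?num_real.
exists (s^-1 *: x); split; last 2 first.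
- by exists s^-1.
- move=> w; rewrite /reflect_in !formZl !formZr scalerA; congr (_ - _ *: _).
  rewrite (_ : _ * s^-1 = 2 * h x w * (s^-1 * s^-1) * (s^-1 * s^-1) * h x x); last by ring.
  rewrite sV -!mulrA; congr (_ * (_ * _)).
  rewrite mulrA -invfM xx invfM -mulrA mulVf // mulr1.
  by [].
by rewrite formZl formZr mulrA sV normrM normfV normr_id mulVf // normr_eq0.
Qed.

Variables (n : nat) (b : n.-tuple V).
Hypothesis hb : orthonormal_basis h b.
Local Notation e := (tnth b).

Let e_unit i : `|h (e i) (e i)| = 1. Proof. by case: hb. Qed.
Let e_orth i j : i != j -> h (e i) (e j) = 0. Proof. by case: hb => _ + _; exact. Qed.
Let e_basis : basis_of fullv b. Proof. by case: hb. Qed.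

Lemma orthonormal_eq0 v : (forall i, h v (e i) = 0) -> v = 0.
Proof.
move=> hv; have ev := coord_basis e_basis (memvf v).
rewrite ev; apply: big1 => i _.
have : h v (e i) = coord b i v * h (e i) (e i).
  rewrite {1}ev linear_sumlz (bigD1 i) //= big1 => [|j ji].
    by rewrite -tnth_nth -/(e i) formZl addr0.
  by rewrite -tnth_nth formZl e_orth // mulr0.
rewrite hv => /esym/eqP; rewrite mulf_eq0 => /orP[/eqP->|/eqP ei].
  by rewrite scale0r.
by have := e_unit i; rewrite ei normr0 => /eqP; rewrite eq_sym oner_eq0.
Qed.

Lemma reflections_isometry vs : unit_vectors h vs -> isometry (reflections vs).
Proof.
elim: vs => [|v vs IH] hvs x y //=.
rewrite reflect_in_isometry; last exact/hvs/mem_head.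
by apply: IH => w hw; apply/hvs/mem_behead.
Qed.

Lemma reflections_cat us vs w :
  reflections (us ++ vs) w = reflections us (reflections vs w).
Proof. exact: foldr_cat. Qed.

Lemma reflections_revK us w : unit_vectors h us ->
  reflections (rev us) (reflections us w) = w.
Proof.
elim: us w => [|v us IH] w hus //=; rewrite rev_cons -cats1 reflections_cat /=.
rewrite reflect_inK ?IH //; last exact/hus/mem_head.
by move=> x hx; apply/hus/mem_behead.
Qed.

Lemma reflections_orth us w : (forall u, u \in us -> h u w = 0) ->
  reflections us w = w.
Proof.
elim: us => [//|u us IH] hus /=; rewrite IH => [|x hx]; last exact/hus/mem_behead.
by apply: reflect_in_orth; apply/hus/mem_head.
Qed.

(** The sum of [h (x - y) (x - y)] and [h (x + y) (x + y)] is [4 h y y], so one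
    of the two vectors is not isotropic.  Reflecting in [x - y] exchanges [x]
    and [y]; reflecting in [x + y] sends [x] to [- y], which the reflection in
    [y] corrects. *)
Lemma reflections_move x y : `|h y y| = 1 -> h x x = h y y ->
  exists us, [/\ unit_vectors h us, reflections us x = y &
    forall u, u \in us -> exists a c, u = a *: x + c *: y].
Proof.
move=> y1 xy; have y0 : h y y != 0 by rewrite -normr_eq0 y1 oner_eq0.
have [d0|d0] := eqVneq (h (x - y) (x - y)) 0.
  have xye : h x y = h y y.
    move: d0; rewrite !(formDl, formDr, formNl, formNr) xy (formC y x).
    by move=> d0; lra.
  have s0 : h (x + y) (x + y) = 4 * h y y.
    by rewrite !(formDl, formDr) xy (formC y x) xye; ring.
  have [|v [v1 [a va] hv]] := @normalize_vector (x + y); first by rewrite s0 mulf_neq0 ?pnatr_eq0.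
  exists [:: y; v]; split.
  - by move=> u; rewrite !inE => /orP[]/eqP ->.
  - rewrite /= hv s0 formDl xy (formC y x) xye.
    rewrite (_ : 2 * _ / _ = 1); last by field.
    rewrite scale1r opprD addrA subrr add0r /reflect_in formNr.
    rewrite (_ : 2 * _ * _ = -2 * (h y y * h y y)); last by ring.
    by rewrite normr1_sqr // mulr1 -scaleNr opprK -scaleN1r -scalerDl
      (_ : -1 + 2 = 1) ?scale1r //; ring.
  move=> u; rewrite !inE => /orP[]/eqP ->.
    by exists 0, 1; rewrite scale0r scale1r add0r.
  by exists a, a; rewrite va scalerDr.
have [v [v1 [a va] hv]] := normalize_vector d0.
exists [:: v]; split.
- by move=> u; rewrite inE => /eqP ->.
- rewrite /= hv.
  have -> : 2 * h (x - y) x / h (x - y) (x - y) = 1.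
    move: d0; rewrite !(formDl, formDr, formNl, formNr) xy (formC y x).
    by move=> d0; field; move: d0; rewrite (_ : _ + _ = 2 * (h y y - h x y));
      [move=> d0; lra | ring].
  by rewrite scale1r opprB addrC subrK.
by move=> u; rewrite inE => /eqP ->; exists a, (- a); rewrite va scalerBr scaleNr.
Qed.

(** Induction on the number of basis vectors that [g] need not fix.  The
    reflections that move the image of the next basis vector back are in
    combinations of this vector and its image, hence orthogonal to the vectors
    already fixed, and do not disturb them. *)
Theorem cartan_dieudonne g : isometry g ->
  exists2 vs, unit_vectors h vs & forall w, g w = reflections vs w.
Proof.
move=> hg; suff: forall m (g : V -> V), isometry g ->
   (forall i : 'I_n, (i < n - m)%N -> g (e i) = e i) ->
   exists2 vs, unit_vectors h vs & forall w, g w = reflections vs w.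
  by move=> /(_ n g hg); apply=> i; rewrite subnn.
elim=> [|m IH] {hg}g hg fix_g.
  exists [::] => // w; apply/eqP; rewrite -subr_eq0; apply/eqP/orthonormal_eq0 => i.
  by rewrite formDl formNl -{1}(fix_g i) ?subn0 // hg subrr.
have [nm|mn] := leqP n m.
  by apply: IH => // i; rewrite (eqP (nm : (n - m == 0)%N)).
have i0P : (n - m.+1 < n)%N by rewrite subnSK // leq_subr.
pose i0 := Ordinal i0P.
have [us [us1 use usP]] := reflections_move (e_unit i0) (hg (e i0) (e i0)).
have [w|i hi|vs vs1 hvs] := IH (fun w => reflections us (g w)).
- by move=> v; rewrite reflections_isometry.
- have [->//|ii0] := eqVneq i i0.
  have lt_i : (i < n - m.+1)%N.
    rewrite ltn_neqAle -[(n - m.+1)%N]/(val i0) (inj_eq val_inj) ii0 /=.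
    by rewrite -ltnS subnSK.
  rewrite fix_g // reflections_orth // => u /usP[a [c ->]].
  rewrite formDl !formZl -{1}(fix_g i) // hg.
  by rewrite e_orth ?mulr0 ?addr0 // eq_sym.
exists (rev us ++ vs).
  by apply: unit_vectors_cat => // u; rewrite mem_rev; apply: us1.
by move=> w; rewrite reflections_cat -hvs reflections_revK.
Qed.

End Isometries.

Section CliffordVectors.
Variables (R : realType) (V : vectType R) (h : {symmetric V}).
Variables (C : algType R) (iota : {linear V -> C}).
Hypothesis hC : is_clifford_algebra h iota.

Lemma clifford_anticomm v w :
  iota v * iota w + iota w * iota v = (2 * h v w)%:A.
Proof.
have := clifford_sqr hC (v + w); rewrite linearD mulrDl !mulrDr !(clifford_sqr hC).
rewrite formDl !formDr (formC h w v) => e.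
apply: (addrI (h v v)%:A); apply: (addIr (h w w)%:A).
rewrite !addrA in e *; rewrite e -!scalerDl; congr (_ *: _); ring.
Qed.

Lemma iota_reflect v w : `|h v v| = 1 ->
  iota v * iota w = - (iota (reflect_in h v w) * iota v).
Proof.
move=> /normr1_sqr v1; rewrite /reflect_in linearB linearZ /= mulrBl opprB.
rewrite -scalerAl (clifford_sqr hC) scalerA -!mulrA v1 mulr1.
by rewrite -clifford_anticomm addrK.
Qed.

(** Conjugation by a product of unit vectors is, up to a sign for each factor,
    the product of the reflections. *)
Lemma word_reflections vs w : unit_vectors h vs ->
  word iota vs * iota w =
  (-1) ^+ size vs *: (iota (reflections h vs w) * word iota vs).
Proof.
elim: vs => [|v vs IH] hvs; first by rewrite word_nil mul1r mulr1 scale1r.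
rewrite word_cons -mulrA IH => [|u hu]; last exact/hvs/mem_behead.
rewrite -scalerAr (mulrA (iota v)) iota_reflect; last exact/hvs/mem_head.
by rewrite mulNr scalerN -scaleNr -mulrA exprS mulN1r.
Qed.

End CliffordVectors.

(** * The endomorphism algebra and its similitudes *)

Section EndomorphismAlgebra.
Variables (R : realType) (S : vectType R) (S_proper : (0 < dim S)%N).

(** Linear endomorphisms with composition as product; the unit is nonzero only
    for a nonzero space, hence the dependence on a proof. *)
Definition endo_ring : nzRingType :=
  HB.pack 'End(S) (lfun_comp_nzRingMixin S_proper).

Definition endo_lalg : lalgType R :=
  HB.pack 'End(S) endo_ring (GRing.Lmodule_isLalgebra.Build R endo_ring
    (fun k x y => comp_lfunZl k x y)).

Definition endo_alg : algType R :=
  HB.pack 'End(S) endo_lalg (GRing.Lalgebra_isAlgebra.Build R endo_lalg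
    (fun k x y => comp_lfunZr k x y)).

Lemma endo_mul_app (a b : endo_alg) (x : S) :
  ((a * b : endo_alg) : 'End(S)) x = (a : 'End(S)) ((b : 'End(S)) x).
Proof. exact: comp_lfunE. Qed.

Lemma endo_scalar_app (c : R) (x : S) :
  ((c%:A : endo_alg) : 'End(S)) x = c *: x.
Proof. by rewrite scale_lfunE; congr (_ *: _); rewrite lfunE. Qed.

Lemma endo_lker0 (a a' : endo_alg) : a' * a = 1 -> lker (a : 'End(S)) == 0%VS.
Proof.
move=> a'a; apply/lker0P => x y /(congr1 (a' : 'End(S))).
by rewrite -!endo_mul_app a'a !lfunE.
Qed.

Lemma endo_inv (a a' : endo_alg) : a' * a = 1 -> (a^-1)%VF = a' :> 'End(S).
Proof.
move=> a'a; have a0 := endo_lker0 a'a.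
have aV : a * ((a^-1)%VF : endo_alg) = 1 := lker0_compfV a0.
by rewrite -[LHS](mul1r (_ : endo_alg)) -a'a -mulrA aV mulr1.
Qed.

Section Similitudes.
Variables (eps : bool) (B : {hermitian S for eps & idfun}).

(** For an invertible [a] this says that the transpose of [a] times [a] is the
    scalar [r]; it spares the transpose. *)
Definition similitude (a : endo_alg) (r : R) :=
  forall x y, B ((a : 'End(S)) x) ((a : 'End(S)) y) = r * B x y.

Lemma similitude1 : similitude 1 1.
Proof. by move=> x y; rewrite !lfunE mul1r. Qed.

Lemma similitudeM a b r t :
  similitude a r -> similitude b t -> similitude (a * b) (r * t).
Proof. by move=> ha hb x y; rewrite !endo_mul_app ha hb mulrA. Qed.

Lemma similitudeV a a' r : r != 0 -> a * a' = 1 ->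
  similitude a r -> similitude a' r^-1.
Proof.
move=> r0 aa' ha x y; apply: (mulfI r0); rewrite -ha -!endo_mul_app aa' !lfunE.
by rewrite mulrA mulfV // mul1r.
Qed.

Lemma pairingZr (d : R) x y : B x (d *: y) = d * B x y. Proof. exact: linearZr. Qed.

Lemma pairingDr x y z : B x (y + z) = B x y + B x z. Proof. exact: linearDr. Qed.

Lemma pairingDl x y z : B (x + y) z = B x z + B y z. Proof. exact: linearDl. Qed.

Lemma pairingNr x y : B x (- y) = - B x y. Proof. exact: linearNr. Qed.

Lemma pairingZl (c : R) x y : B (c *: x) y = c * B x y.
Proof. exact: linearZl_LR. Qed.

Hypothesis B_nondeg : nondegenerate B.

Lemma form_inj_r (x y : S) : (forall z, B z x = B z y) -> x = y.
Proof.
move=> hxy; apply/eqP; rewrite -subr_eq0 -memv0 -(eqP B_nondeg).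
apply/mem_orthovP => z _; rewrite hermC /= linearB /= hxy subrr mulr0 //.
Qed.

Lemma form_neq0 : exists x y, B x y != 0.
Proof.
apply: contrapT => hB.
have S0 (x : S) : x = 0.
  apply: form_inj_r => z; rewrite linear0r; apply/eqP/negPn/negP => h.
  by apply: hB; exists z, x.
have /eqP := lfun1_neq0 S_proper; apply.
by apply/lfunP => x; rewrite !lfunE [x]S0.
Qed.

Lemma similitude_scalar (c r : R) : similitude c%:A r -> r = c ^+ 2.
Proof.
move=> hc; have [x [y xy]] := form_neq0; apply: (mulIf xy).
by rewrite -hc !endo_scalar_app pairingZr pairingZl expr2 mulrA.
Qed.

Lemma similitude_scalar_unit (c r : R) : similitude c%:A r -> `|r| = 1 ->
  c = 1 \/ c = -1.
Proof.
move=> /similitude_scalar-> h; have : c ^+ 2 = 1 by rewrite -h ger0_norm ?sqr_ge0.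
by move/eqP; rewrite sqrf_eq1 => /orP[]/eqP; [left|right].
Qed.

Lemma similitude_transpose (a a' : endo_alg) r : is_transpose B a a' ->
  similitude a r <-> a' * a = r%:A.
Proof.
move=> ha; split=> [hr|e x y]; last first.
  by rewrite ha -endo_mul_app e endo_scalar_app pairingZr.
apply/lfunP => y; apply: form_inj_r => z.
by rewrite endo_mul_app -ha hr endo_scalar_app pairingZr.
Qed.

End Similitudes.
End EndomorphismAlgebra.

(** * Isomorphisms from groups and from quotients by a common sign *)

Section DotGroups.
Variables (C1 C2 E : nzRingType) (G1 : set C1) (G2 : set C2) (K : set E).
Variables (f1 : C1 -> E) (f2 : C2 -> E).
Hypotheses (hG1 : is_group *%R 1 G1) (hG2 : is_group *%R 1 G2).
Hypothesis hK : is_group *%R 1 K.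
Hypotheses (f1N : forall x, f1 (- x) = - f1 x) (f2N : forall x, f2 (- x) = - f2 x).

Lemma group_iso_kernel :
  (forall x y, G1 x -> G1 y -> f1 (x * y) = f1 x * f1 y) ->
  (forall x, G1 x -> K (f1 x)) ->
  (forall k, K k -> exists2 x, G1 x & k = f1 x) ->
  (forall x, G1 x -> f1 x = 1 -> x = 1) ->
  group_iso *%R 1 G1 *%R 1 K f1.
Proof.
move=> f1M f1K surj ker; split=> //; split=> [x /f1K//|x y|k /surj[x Gx ->]].
  move=> /set_mem Gx /set_mem Gy exy.
  case: hG1 => _ GM _ _ GV; have [y' [Gy' yy' y'y]] := GV _ Gy.
  have : x * y' = 1.
    by apply: ker; [apply: GM|rewrite f1M // exy -f1M // yy'; case: hG1 => G11 _ _ _ _;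
      have := f1M _ _ G11 G11; rewrite mulr1; case: hK => _ _ _ _ KV;
      have [z [_ _ zf]] := KV _ (f1K _ G11) => /(congr1 (fun t => z * t));
      rewrite mulrA zf mul1r].
  by move=> /(congr1 (fun t => t * y)); rewrite -mulrA y'y mulr1 mul1r.
by exists x.
Qed.

Lemma mulset_pmcoset (C : nzRingType) (x y : C) :
  mulset (pmcoset x) (pmcoset y) = pmcoset (x * y).
Proof.
apply/seteqP; split=> z.
  by move=> [u [v [[->|->] [->|->] ->]]]; rewrite /pmcoset /= ?mulNr ?mulrN ?opprK; auto.
case=> ->; first by exists x, y; split=> //; left.
by exists (- x), y; split; [right|left|rewrite mulNr].
Qed.

Lemma dotgroup_group : is_group (@mulset _) (pmcoset 1) (dotgroup G1 G2).
Proof.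
case: hG1 => G11 M1 _ _ V1; case: hG2 => G21 M2 _ _ V2.
split.
- by exists 1.
- move=> _ _ [x [x1 x2] <-] [y [y1 y2] <-]; rewrite mulset_pmcoset.
  by exists (x * y) => //; split; [apply: M1|apply: M2].
- move=> _ _ _ [x _ <-] [y _ <-] [z _ <-].
  by rewrite !mulset_pmcoset mulrA.
- by move=> _ [x _ <-]; rewrite !mulset_pmcoset mul1r mulr1.
move=> _ [[x1 x2] [/V1[y1 [Gy1 xy1 yx1]] /V2[y2 [Gy2 xy2 yx2]]] <-].
exists (pmcoset (y1, y2)); rewrite !mulset_pmcoset.
split; first by exists (y1, y2).
  by congr pmcoset; apply/eqP; rewrite xpair_eqE /= xy1 xy2 !eqxx.
by congr pmcoset; apply/eqP; rewrite xpair_eqE /= yx1 yx2 !eqxx.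
Qed.

(** The product [f1 x * f2 y] is unchanged when both arguments change sign, so
    it may be evaluated at any element of the coset. *)
Lemma dotgroup_iso :
  (forall x y, G1 x -> G1 y -> f1 (x * y) = f1 x * f1 y) ->
  (forall x y, G2 x -> G2 y -> f2 (x * y) = f2 x * f2 y) ->
  (forall x y, G1 x -> G2 y -> f1 x * f2 y = f2 y * f1 x) ->
  (forall x y, G1 x -> G2 y -> K (f1 x * f2 y)) ->
  (forall k, K k -> exists x y, [/\ G1 x, G2 y & k = f1 x * f2 y]) ->
  (forall x y, G1 x -> G2 y -> f1 x * f2 y = 1 ->
     (x = 1 /\ y = 1) \/ (x = -1 /\ y = -1)) ->
  exists phi : set (C1 * C2) -> E,
    (forall x y, phi (pmcoset (x, y)) = f1 x * f2 y) /\
    group_iso (@mulset _) (pmcoset 1) (dotgroup G1 G2) *%R 1 K phi.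
Proof.
move=> f1M f2M f12 hfK surj ker.
pose F (z : C1 * C2) := f1 z.1 * f2 z.2.
pose phi (X : set (C1 * C2)) := F (xget 0 X).
have phiE x y : phi (pmcoset (x, y)) = f1 x * f2 y.
  have : pmcoset (x, y) (xget 0 (pmcoset (x, y))).
    by apply: (@xgetPex _ 0); exists (x, y); left.
  by rewrite /phi /F; case=> ->; rewrite //= f1N f2N mulrNN.
have FM x y : G1 x.1 -> G2 x.2 -> G1 y.1 -> G2 y.2 -> F (x * y) = F x * F y.
  move=> x1 x2 y1 y2; rewrite /F f1M // f2M // !mulrA; congr (_ * _).
  by rewrite -!mulrA f12.
exists phi; split=> //; split=> //; first exact: dotgroup_group.
  split=> [_ [[x y] [/= x1 y1] <-]|X Y /set_mem[[x y] [/= x1 y1] <-]|k].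
  - by rewrite phiE; apply: hfK.
  - move=> /set_mem[[u v] [/= u1 v1] <-]; rewrite !phiE => e.
    case: hG1 => _ M1 _ _ V1; have [u' [Gu' uu' u'u]] := V1 _ u1.
    case: hG2 => _ M2 _ _ V2; have [v' [Gv' vv' v'v]] := V2 _ v1.
    have F1 : F 1 = 1.
      case: hG1 => G11 _ _ _ _; case: hG2 => G21 _ _ _ _.
      have := FM 1 1 G11 G21 G11 G21; rewrite mulr1.
      case: hK => _ _ _ _ KV; have [z [_ _ zf]] := KV _ (hfK _ _ G11 G21).
      by move=> /(congr1 (fun t => z * t)); rewrite mulrA zf mul1r.
    have : F ((x, y) * (u', v')) = 1.
      rewrite FM //= [F (x, y)]e -[f1 u * f2 v]/(F (u, v)) -FM //=.
      rewrite -F1; congr F; apply/eqP.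
      by rewrite xpair_eqE /= uu' vv' !eqxx.
    move=> /(ker _ _ (M1 _ _ x1 Gu') (M2 _ _ y1 Gv'))[] /= [e1 e2].
      congr (pmcoset (_, _)).
        by rewrite -[LHS]mulr1 -u'u mulrA e1 mul1r.
      by rewrite -[LHS]mulr1 -v'v mulrA e2 mul1r.
    have -> : (x, y) = - (u, v).
      congr (_, _).
        by rewrite -[LHS]mulr1 -u'u mulrA e1 mulN1r.
      by rewrite -[LHS]mulr1 -v'v mulrA e2 mulN1r.
    apply/seteqP; split=> z [] ->; rewrite /pmcoset /= ?opprK; auto.
  move=> /surj[x [y [x1 y1 ->]]]; exists (pmcoset (x, y)); last exact: phiE.
  by exists (x, y).
move=> _ _ [[x y] [/= x1 y1] <-] [[u v] [/= u1 v1] <-].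
rewrite mulset_pmcoset !phiE.
by rewrite -[LHS]/(F ((x, y) * (u, v))) FM.
Qed.

End DotGroups.

(** * Exponentials of multiples of a square root of minus one *)

Section Exponential.
Variables (R : realType) (A : algType R) (J : A).
Hypothesis JJ : J * J = -1.

Lemma power_term (t : R) k (l : {scalar A}) :
  l ((k`!%:R)^-1 *: iter k ( *%R (t *: J)) 1) =
  cos_coeff t k * l 1 + sin_coeff t k * l J.
Proof.
have -> : iter k ( *%R (t *: J)) 1 =
    t ^+ k *: ((-1) ^+ k./2 *: (if odd k then J else 1)).
  elim: k => [|k IH]; first by rewrite !expr0 !scale1r.
  rewrite iterS IH -scalerAl -!scalerAr !scalerA /= uphalf_half exprS.
  case: (odd k) => /=; last by rewrite mulr1 add0n mulrA.
  by rewrite JJ scalerN -scaleNr add1n exprS mulN1r mulrN mulrA.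
rewrite !scalerA linearZ /cos_coeff /sin_coeff /= -?exprnP -[LHS]/(_ * _).
case ok : (odd k) => /=; last by ring.
have -> : k.-1./2 = k./2; last by ring.
by rewrite -[k]odd_double_half ok add1n /= uphalf_double doubleK.
Qed.

Lemma is_exp_rotation (t : R) :
  is_exp *%R 1 (t *: J) (cos t *: 1 + sin t *: J).
Proof.
move=> l; under eq_fun do (under [X in series X]eq_fun do rewrite power_term).
have -> : series (fun k => cos_coeff t k * l 1 + sin_coeff t k * l J) =
    (fun n => series (cos_coeff t) n * l 1 + series (sin_coeff t) n * l J).
  apply/funext => n; rewrite /series /= big_split /= !mulr_suml.
  by [].
rewrite linearD !linearZ /=.
apply: cvgD; apply: cvgM; try exact: cvg_cst.
  by rewrite [cos t](_ : _ = lim (series (cos_coeff t) @ \oo)); [exact: is_cvg_series_cos_coeff|rewrite unlock].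
by rewrite [sin t](_ : _ = lim (series (sin_coeff t) @ \oo)); [exact: is_cvg_series_sin_coeff|rewrite unlock].
Qed.

(** The series determines the values of all linear forms at its sum; where these
    separate points, the sum is unique. *)
Lemma expA_rotation (t : R) :
  (forall z : A, (forall l : {scalar A}, l z = 0) -> z = 0) ->
  expA *%R 1 (t *: J) = cos t *: 1 + sin t *: J.
Proof.
move=> sep; rewrite /expA; case: xgetP => [y _ hy|]; last first.
  by move=> no_exp; case: (no_exp _ (@is_exp_rotation t)).
apply/eqP; rewrite -subr_eq0; apply/eqP/sep => l.
rewrite linearB; apply/eqP; rewrite subr_eq0; apply/eqP.
exact: (cvg_unique _ (hy l) (@is_exp_rotation t l)).
Qed.

End Exponential.

(** * The Clifford algebra of an orthonormal basis *)

Section OrthonormalClifford.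
Variables (R : realType) (V : vectType R) (h : {symmetric V}).
Variables (C : algType R) (iota : {linear V -> C}).
Hypothesis hC : is_clifford_algebra h iota.
Variables (n : nat) (b : n.-tuple V).
Hypothesis hb : orthonormal_basis h b.

Definition basis_family : seq (R * C) := [seq (h v v, iota v) | v <- b].

Let b_unit v : v \in tval b -> `|h v v| = 1.
Proof. by case/tnthP=> i ->; case: hb. Qed.

Lemma orthonormal_pairwise : pairwise (fun v w => h v w == 0) b.
Proof.
apply/(pairwiseP 0) => i j; rewrite !inE size_tuple => hi hj ij; apply/eqP.
rewrite -!(tnth_nth 0 b (Ordinal _)) //; case: hb => _ + _; apply.
by rewrite -val_eqE /= neq_ltn ij.
Qed.

Lemma basis_familyP : clifford_family basis_family.
Proof.
rewrite /basis_family; move: orthonormal_pairwise b_unit.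
elim: (tval b) => //= v vs IH /andP[vvs pvs] hu; split.
- exact/hu/mem_head.
- exact: (clifford_sqr hC).
- move=> _ /mapP[w wvs ->] /=.
  have := clifford_anticomm hC w v.
  rewrite formC (eqP (allP vvs w wvs)) mulr0 scale0r => /eqP.
  by rewrite addr_eq0 => /eqP.
by apply: IH => // w hw; apply: hu; rewrite inE hw orbT.
Qed.

Lemma size_basis_family : size basis_family = n.
Proof. by rewrite size_map size_tuple. Qed.

Lemma volume_family : volume iota b = family_volume basis_family.
Proof. by rewrite /volume /family_volume big_map big_tuple. Qed.

Lemma volume_word : volume iota b = word iota b.
Proof. by rewrite volume_family /family_volume big_map. Qed.

Lemma unit_vectors_basis : unit_vectors h b. Proof. exact: b_unit. Qed.

Lemma basis_expand v : exists c : 'I_n -> R,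
  iota v = \sum_i c i *: iota (tnth b i).
Proof.
have e_basis : basis_of fullv b by case: hb.
exists (coord b ^~ v); rewrite {1}(coord_basis e_basis (memvf v)) linear_sum.
by apply: eq_bigr => i _; rewrite linearZ -tnth_nth.
Qed.

(** Commutation up to a scalar [c] is linear in [v], so it is enough to have it
    on a basis. *)
Lemma commutes_basis (B : algType R) (f : {lrmorphism C -> B}) (s : B) (c : R) :
  (forall i, s * f (iota (tnth b i)) = c *: (f (iota (tnth b i)) * s)) ->
  forall v, s * f (iota v) = c *: (f (iota v) * s).
Proof.
move=> hs v; have [a ->] := basis_expand v.
rewrite linear_sum mulr_sumr mulr_suml scaler_sumr; apply: eq_bigr => i _.
by rewrite linearZ /= -scalerAr hs -scalerAl !scalerA mulrC.
Qed.

Lemma graded_span_word vs : graded_span basis_family (odd (size vs)) (word iota vs).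
Proof.
elim/last_ind: vs => [|vs v IH]; first by rewrite word_nil; exact: graded_span1.
rewrite -cats1 word_cat word_seq1 size_cat addn1 /=.
have [c ->] := basis_expand v; rewrite mulr_sumr; apply: graded_span_sum => i.
rewrite -scalerAr; apply: graded_spanZ.
apply: (graded_span_mul (f := (h (tnth b i) (tnth b i), iota (tnth b i)))) => //.
  exact: basis_familyP.
by apply/mapP; exists (tnth b i) => //; apply: mem_tnth.
Qed.

Lemma even_word_central vs : ~~ odd (size vs) ->
  (forall v, word iota vs * iota v = iota v * word iota vs) ->
  exists c : R, word iota vs = c%:A.
Proof.
move=> ev hvs; apply: (graded_span_central basis_familyP).
  by have := graded_span_word vs; rewrite (negbTE ev).
by move=> _ /mapP[v _ ->]; apply: hvs.
Qed.

Lemma volume_comm v :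
  volume iota b * iota v = (-1) ^+ n.-1 *: (iota v * volume iota b).
Proof.
apply: (commutes_basis (f := idfun)) => i.
have fam_i : (h (tnth b i) (tnth b i), iota (tnth b i)) \in basis_family.
  by apply/mapP; exists (tnth b i) => //; apply: mem_tnth.
have := family_volume_comm basis_familyP fam_i.
by rewrite size_basis_family -volume_family.
Qed.

Lemma volume_comm_word vs : ~~ odd n -> (0 < n)%N ->
  volume iota b * word iota vs =
  (-1) ^+ size vs *: (word iota vs * volume iota b).
Proof.
move=> ev n0; elim: vs => [|v vs IH]; first by rewrite word_nil mul1r mulr1 scale1r.
have sgn : (-1) ^+ n.-1 = -1 :> R by rewrite signr_pred // signr_even_eq.
rewrite word_cons mulrA volume_comm sgn -scalerAl -(mulrA _ (volume iota b)) IH -scalerAr scalerA.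
by rewrite /= exprS mulrA.
Qed.

Lemma volume_sqr_sign : exists2 s : R, `|s| = 1 &
  volume iota b * volume iota b = s%:A.
Proof.
exists ((-1) ^+ 'C(n, 2) * \prod_(f <- basis_family) f.1).
  rewrite normrM normrX normrN1 expr1n mul1r normr_prod big_map big_seq.
  by apply: big1 => v; apply: b_unit.
by rewrite volume_family (family_volume_sqr basis_familyP) size_basis_family.
Qed.

Lemma volume_central x : (0 < n)%N -> odd n ->
  volume iota b * x = x * volume iota b.
Proof.
move=> n0 on; have sgn : (-1) ^+ n.-1 = 1 :> R.
  by rewrite signr_pred // signr_odd_eq // opprK.
have [ws ->] := clifford_word_span hC x.
rewrite mulr_sumr mulr_suml; apply: eq_bigr => w _.
rewrite -scalerAl -scalerAr; congr (_ *: _).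
elim: w.2 => [|v vs IH]; first by rewrite word_nil mulr1 mul1r.
by rewrite word_cons mulrA volume_comm sgn scale1r -mulrA IH mulrA.
Qed.

Section Signature.
Variables p q : nat.
Hypothesis hp : #|[set i | 0 < h (tnth b i) (tnth b i)]%SET| = p.
Hypothesis hq : #|[set i | h (tnth b i) (tnth b i) < 0]%SET| = q.

Lemma count_tuple (a : pred V) : count a b = #|[set i | a (tnth b i)]%SET|.
Proof. by rewrite -sum1_count big_tuple sum1dep_card. Qed.

Lemma count_positive : count (fun f => 0 < f.1) basis_family = p.
Proof. by rewrite count_map -hp -(count_tuple (fun v => 0 < h v v)). Qed.

Lemma count_negative : count (fun f => f.1 < 0) basis_family = q.
Proof. by rewrite count_map -hq -(count_tuple (fun v => h v v < 0)). Qed.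

Lemma volume_sqr :
  volume iota b * volume iota b = ((-1) ^+ 'C(n, 2) * (-1) ^+ q)%:A.
Proof.
rewrite volume_family (family_volume_sqr basis_familyP) size_basis_family.
congr (_ * _)%:A; rewrite /basis_family big_map -count_negative count_map.
move: b_unit; elim: (tval b) => [|v vs IH] hu; first by rewrite big_nil.
rewrite big_cons IH => [|w hw]; last by apply: hu; rewrite inE hw orbT.
have v1 := hu v (mem_head _ _); rewrite /= exprD; congr (_ * _).
have [v0|v0|v0] := ltgtP (h v v) 0.
- by rewrite expr1 -v1 ltr0_norm ?opprK.
- by rewrite expr0 -v1 gtr0_norm.
by move: v1; rewrite v0 normr0 => /eqP; rewrite eq_sym oner_eq0.
Qed.
End Signature.

Lemma Pin_volume : Pin h iota (volume iota b).
Proof. by apply/(PinP hC); exists b; [exact: b_unit|exact: volume_word]. Qed.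

Lemma SpinN x : (0 < n)%N -> Spin h iota x -> Spin h iota (- x).
Proof.
move=> n0 hx; pose v := tnth b (Ordinal n0).
have v1 : `|h v v| = 1 by case: hb => _ _; apply.
have -> : - x = word iota [:: v; - h v v *: v] * x.
  rewrite !word_cons word_nil mulr1 linearZ /= -scalerAr (clifford_sqr hC).
  by rewrite scalerA mulNr normr1_sqr // scaleN1r mulN1r.
apply: (Spin_mul hC) => //; apply/(SpinP hC); exists [:: v; - h v v *: v]; split=> //.
move=> w; rewrite !inE => /orP[]/eqP-> //.
by rewrite (clifford_sqrZ hC) normrM normrX normrN v1 expr1n mul1r.
Qed.

Lemma PinN x : (0 < n)%N -> Pin h iota x -> Pin h iota (- x).
Proof.
move=> n0 hx; rewrite -mulN1r; apply: generated_mul; last exact: hx.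
have S1 : Spin h iota 1 by case: (Spin_group hC).
by case: (SpinN n0 S1).
Qed.

End OrthonormalClifford.

(** For [n] odd both volume elements are central, and their product is even, so
    it is a scalar; thus the two differ by a real factor, and as both squares
    are [1] or [-1] this factor squares to one. *)
Lemma volume_sqr_indep (R : realType) (V : vectType R) (h : {symmetric V})
    (C : algType R) (iota : {linear V -> C}) n (b b' : n.-tuple V) :
  is_clifford_algebra h iota -> orthonormal_basis h b ->
  orthonormal_basis h b' -> (0 < n)%N -> odd n ->
  volume iota b' * volume iota b' = volume iota b * volume iota b.
Proof.
move=> hC hb hb' n0 on.
have ev : ~~ odd (size (b' ++ b)) by rewrite size_cat !size_tuple addnn odd_double.
have eb'b : word iota (b' ++ b) = volume iota b' * volume iota b.
  by rewrite word_cat -!(volume_word h).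
have [v|r er] := even_word_central hC hb ev.
  rewrite eb'b -mulrA (volume_central hC hb) // mulrA (volume_central hC hb') //.
  by rewrite mulrA.
have [s s1 es] := volume_sqr_sign hC hb.
have [s' s'1 es'] := volume_sqr_sign hC hb'.
have ss : s * s = 1 := normr1_sqr s1.
have eb' : volume iota b' = (r * s) *: volume iota b.
  have := congr1 (fun z => z * volume iota b) er.
  rewrite eb'b -mulrA es -scalerAr mulr1 -scalerAl mul1r => e.
  by rewrite mulrC -scalerA -e scalerA ss scale1r.
have : s'%:A = (r ^+ 2 * s)%:A :> C.
  rewrite -es' eb' -scalerAl -scalerAr es !scalerA; congr (_ *: _).
  rewrite -[RHS]mulr1 -ss; ring.
move=> /scalar_inj s's; rewrite es' es s's.
move: s'1; rewrite s's normrM s1 mulr1 ger0_norm ?sqr_ge0 // => ->.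
by rewrite mul1r.
Qed.

(** * The reduced Lipschitz group *)

Lemma lrmorph_scalar (R : realType) (A B : algType R) (f : {lrmorphism A -> B})
  (a : R) : f a%:A = a%:A.
Proof. by rewrite linearZ /= rmorph1. Qed.

Section Lipschitz.
Variables (R : realType) (V : vectType R) (h : {symmetric V}).
Variables (C : algType R) (iota : {linear V -> C}).
Hypothesis hC : is_clifford_algebra h iota.
Variables (n : nat) (b : n.-tuple V).
Hypothesis hb : orthonormal_basis h b.
Hypothesis n_gt0 : (0 < n)%N.
Variables (S : vectType R) (S_proper : (0 < dim S)%N).
Local Notation E := (endo_alg S_proper).
Variable g : {lrmorphism C -> E}.
Variables (eps : bool) (B : {hermitian S for eps & idfun}).
Hypothesis B_nondeg : nondegenerate B.
Variable ty : bool.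
Hypothesis B_adapted :
  forall v, is_transpose B (g (iota v)) ((-1) ^+ ty *: g (iota v)).
Local Notation gi v := (g (iota v)).
Local Notation sim := (similitude (S_proper := S_proper) B).

Definition commuting (s : E) := forall v, s * gi v = gi v * s.

Definition lipschitz_unit (a : E) := exists a' : E,
  [/\ a * a' = 1, a' * a = 1 & forall v, exists w, a * gi v = gi w * a].

(** The reduced Lipschitz group with the norm expressed by similitudes; see
    [reduced_lipschitz_groupE]. *)
Definition reduced (a : E) :=
  lipschitz_unit a /\ exists2 r : R, `|r| = 1 & sim a r.

Lemma gi_sqr v : gi v * gi v = (h v v)%:A.
Proof. by rewrite -rmorphM /= (clifford_sqr hC) lrmorph_scalar. Qed.

Lemma gi_anticomm v w : gi v * gi w + gi w * gi v = (2 * h v w)%:A.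
Proof. by rewrite -!rmorphM -rmorphD /= (clifford_anticomm hC) lrmorph_scalar. Qed.

(** The anticommutators with the basis vectors recover [h], which is
    nondegenerate. *)
Lemma gi_inj v w : gi v = gi w -> v = w.
Proof.
move=> vw; apply/eqP; rewrite -subr_eq0; apply/eqP/(orthonormal_eq0 hb) => i.
apply: (mulfI (_ : 2 != 0 :> R)); first by rewrite pnatr_eq0.
apply: (@scalar_inj _ E); rewrite -gi_anticomm !linearB /= vw subrr mul0r mulr0.
by rewrite addr0 mulr0 scale0r.
Qed.

Lemma lipschitz_isometry a : lipschitz_unit a -> exists2 vs,
  unit_vectors h vs & forall v, a * gi v = gi (reflections h vs v) * a.
Proof.
move=> [a' [aa' a'a /choice[f hf]]].
have [v w|vs hvs fE] := cartan_dieudonne hb (g := f); last first.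
  by exists vs => // v; rewrite hf fE.
have e : a * (gi v * gi w + gi w * gi v) =
         (gi (f v) * gi (f w) + gi (f w) * gi (f v)) * a.
  by rewrite mulrDr mulrDl !mulrA !hf -!mulrA !hf !mulrA.
move: e; rewrite !gi_anticomm -scalerAr -scalerAl mulr1 mul1r.
move/(congr1 (fun x => x * a')); rewrite -!scalerAl aa' => /scalar_inj.
by move/mulfI => ->; rewrite // pnatr_eq0.
Qed.

Lemma reduced1 : reduced 1.
Proof.
split; last by exists 1; [rewrite normr1|apply: similitude1].
exists 1; split; rewrite ?mulr1 // => v; exists v.
by rewrite mul1r mulr1.
Qed.

Lemma reducedM a c : reduced a -> reduced c -> reduced (a * c).
Proof.
move=> [[a' [aa' a'a ha]] [r r1 hr]] [[c' [cc' c'c hc]] [t t1 ht]]; split.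
  exists (c' * a'); split.
  - by rewrite mulrA -(mulrA a) cc' mulr1.
  - by rewrite mulrA -(mulrA c') a'a mulr1.
  move=> v; have [w hw] := hc v; have [x hx] := ha w; exists x.
  by rewrite -mulrA hw mulrA hx mulrA.
exists (r * t); first by rewrite normrM r1 t1 mulr1.
exact: similitudeM.
Qed.

(** That the inverse conjugates vectors to vectors is surjectivity of the
    isometry induced by [a], which is clear for a product of reflections. *)
Lemma reducedV a a' : reduced a -> a * a' = 1 -> a' * a = 1 -> reduced a'.
Proof.
move=> [la [r r1 hr]] aa' a'a; split; last first.
  exists r^-1; first by rewrite normfV r1 invr1.
  by apply: (similitudeV _ aa' hr); rewrite -normr_eq0 r1 oner_eq0.
have [vs hvs avs] := lipschitz_isometry la.
exists a; split=> // w; exists (reflections h (rev vs) w).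
have hrev : unit_vectors h (rev vs) by move=> u; rewrite mem_rev; apply: hvs.
have := avs (reflections h (rev vs) w).
rewrite -{2}[vs]revK reflections_revK // => e.
by rewrite -[a' * gi w]mulr1 -aa' mulrA -(mulrA a') -e mulrA a'a mul1r.
Qed.

Lemma reduced_group : is_group *%R 1 reduced.
Proof.
split=> [|a c|a c d _ _ _|a _|a ha].
- exact: reduced1.
- exact: reducedM.
- by rewrite mulrA.
- by rewrite mul1r mulr1.
have [[a' [aa' a'a _]] _] := ha; exists a'; split=> //.
exact: reducedV aa' a'a.
Qed.

Lemma vector_similitude v : sim (gi v) ((-1) ^+ ty * h v v).
Proof.
apply/(similitude_transpose B_nondeg _ (B_adapted v)).
by rewrite -scalerAl gi_sqr scalerA.
Qed.

Lemma reduced_word vs : unit_vectors h vs -> reduced (g (word iota vs)).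
Proof.
elim: vs => [|v vs IH] hvs; first by rewrite word_nil rmorph1; apply: reduced1.
rewrite word_cons rmorphM; apply: reducedM; last first.
  by apply: IH => w hw; apply/hvs/mem_behead.
have v1 : `|h v v| = 1 by apply/hvs/mem_head.
split; last first.
  by exists ((-1) ^+ ty * h v v); [rewrite normrM normr_sign v1 mulr1|apply: vector_similitude].
exists (h v v *: gi v); rewrite -scalerAl -scalerAr gi_sqr scalerA normr1_sqr // scale1r.
split=> // w; exists (- reflect_in h v w).
by rewrite -!rmorphM /= (iota_reflect hC) // [iota (- _)]linearN mulNr.
Qed.

Lemma reduced_Pin x : Pin h iota x -> reduced (g x).
Proof. by move=> /(PinP hC)[vs hvs ->]; apply: reduced_word. Qed.

Lemma reduced_Spin x : Spin h iota x -> reduced (g x).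
Proof. by case=> /reduced_Pin. Qed.

(** Both the elements that commute ([c = 1]) and those that anticommute
    ([c = -1]) with vectors conjugate vectors to vectors. *)
Lemma signed_reduced (s s' : E) (c r : R) : s * s' = 1 -> s' * s = 1 ->
  (forall v, s * gi v = c *: (gi v * s)) -> sim s r -> `|r| = 1 -> reduced s.
Proof.
move=> ss' s's hs hr r1; split; last by exists r.
by exists s'; split=> // v; exists (c *: v); rewrite hs !linearZ -scalerAl.
Qed.

Lemma reduced_factor a : reduced a -> exists vs (s : E),
  [/\ unit_vectors h vs, a = g (word iota vs) * s, reduced s &
      forall v, s * gi v = (-1) ^+ size vs *: (gi v * s)].
Proof.
move=> ra; have [la _] := ra.
have [vs hvs avs] := lipschitz_isometry la.
have [xx' x'x] := word_inverse hC hvs.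
set x := word iota vs in xx' x'x *; set x' := word iota (inverse_word h vs) in xx' x'x.
have gx : g x * g x' = 1 by rewrite -rmorphM xx' rmorph1.
have gx' : g x' * g x = 1 by rewrite -rmorphM x'x rmorph1.
exists vs, (g x' * a); split=> //.
- by rewrite mulrA gx mul1r.
- by apply: reducedM => //; apply: (reducedV (reduced_word hvs) gx gx').
move=> v; rewrite -mulrA avs.
have e : gi (reflections h vs v) * g x = (-1) ^+ size vs *: (g x * gi v).
  have := word_reflections hC v hvs; rewrite -/x => /(congr1 g).
  rewrite linearZ !rmorphM /= => ->.
  by rewrite scalerA -expr2 sqrr_sign scale1r.
rewrite -{1}[a]mul1r -gx -(mulrA (g x)) (mulrA (gi _)) e.
by rewrite -scalerAl -scalerAr !mulrA gx' mul1r.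
Qed.

(** As vectors are represented injectively, the word itself commutes with
    vectors.  An odd word cannot do so for [n] even, as it anticommutes with the
    volume element, a product of vectors; an even word that does is a scalar,
    and the norm of a scalar is its square. *)
Lemma word_kernel vs : unit_vectors h vs -> ~~ odd (size vs) || ~~ odd n ->
  commuting (g (word iota vs)) -> word iota vs = 1 \/ word iota vs = -1.
Proof.
move=> hvs hpar hcom.
have [_ [r r1 hr]] := reduced_word hvs.
have [xx' x'x] := word_inverse hC hvs.
have gx : g (word iota vs) * g (word iota (inverse_word h vs)) = 1.
  by rewrite -rmorphM xx' rmorph1.
have hx v : word iota vs * iota v = iota v * word iota vs.
  have wr : word iota vs * iota v =
      iota ((-1) ^+ size vs *: reflections h vs v) * word iota vs.
    by rewrite linearZ /= -scalerAl (word_reflections hC).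
  rewrite wr; congr (iota _ * _); apply: gi_inj.
  rewrite -[LHS]mulr1 -[RHS]mulr1 -gx !mulrA -(hcom v); congr (_ * _).
  by rewrite -!rmorphM /= wr.
have hev : ~~ odd (size vs).
  have [//|odd_vs] := boolP (~~ odd (size vs)); exfalso.
  rewrite (negbTE odd_vs) /= in hpar; rewrite negbK in odd_vs.
  have := volume_comm_word hC hb vs hpar n_gt0.
  have -> : volume iota b * word iota vs = word iota vs * volume iota b.
    rewrite (volume_word h) //; elim: (tval b) => [|v ws IH].
      by rewrite word_nil mul1r mulr1.
    by rewrite word_cons -mulrA IH mulrA -hx mulrA.
  rewrite -signr_odd odd_vs expr1 scaleN1r => /eqP; rewrite -addr_eq0 -mulr2n.
  have [s s1 ss] := volume_sqr_sign hC hb.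
  move=> /eqP/(congr1 (fun z => word iota (inverse_word h vs) * z * volume iota b)).
  rewrite mulrnAr mulrA x'x mul1r mulr0 mul0r mulrnAl ss -scaler_nat scalerA.
  move/eqP; rewrite scaler_eq0 oner_eq0 orbF mulf_eq0 pnatr_eq0 /=.
  by rewrite -normr_eq0 s1 oner_eq0.
have [c ec] := even_word_central hC hb hev hx.
move: hr; rewrite ec lrmorph_scalar => hr.
have [->|->] := similitude_scalar_unit B_nondeg hr r1; [left|right].
  by rewrite scale1r.
by rewrite scaleN1r.
Qed.

Lemma Spin_kernel x : Spin h iota x -> commuting (g x) -> x = 1 \/ x = -1.
Proof.
by move=> /(SpinP hC)[vs [hvs ev ->]]; apply: word_kernel; rewrite ?ev.
Qed.

Lemma Pin_kernel x : ~~ odd n -> Pin h iota x -> commuting (g x) ->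
  x = 1 \/ x = -1.
Proof.
by move=> ev /(PinP hC)[vs hvs ->]; apply: word_kernel; rewrite ?ev ?orbT.
Qed.

(** The volume element anticommutes with vectors and is moved from [s] to the
    spinorial factor when [s] anticommutes. *)
Lemma reduced_split_even a : ~~ odd n -> reduced a ->
  exists x s, [/\ Pin h iota x, a = g x * s, reduced s & commuting s].
Proof.
move=> ev /reduced_factor[vs [s [hvs -> rs hs]]].
have px : Pin h iota (word iota vs) by apply/(PinP hC); exists vs.
have [even_vs|odd_vs] := boolP (~~ odd (size vs)).
  exists (word iota vs), s; split=> // v.
  by rewrite hs -signr_odd (negbTE even_vs) scale1r.
set nu := volume iota b.
have pnu : Pin h iota nu by apply: Pin_volume.
have [nu' [pnu' nn' n'n]] := Pin_inverse hC pnu.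
exists (word iota vs * nu), (g nu' * s); split.
- exact: generated_mul.
- by rewrite rmorphM /= mulrA -(mulrA (g _)) -[g nu * g nu']rmorphM nn' rmorph1 mulr1.
- by apply: reducedM => //; apply: reduced_Pin.
move=> v; have hnu : nu' * iota v = - (iota v * nu').
  have := volume_comm hC hb v; rewrite -/nu.
  rewrite signr_pred // signr_even_eq // scaleN1r => e.
  rewrite -[nu' * iota v]mulr1 -nn' mulrA -(mulrA nu') -[iota v * nu]opprK -e.
  by rewrite mulrN mulrA n'n mul1r mulNr.
rewrite -mulrA hs -signr_odd (negbNE odd_vs) expr1 scaleN1r mulrN (mulrA (g nu')).
by rewrite -[g nu' * _]rmorphM /= hnu rmorphN rmorphM /= mulNr opprK mulrA.
Qed.

(** An [s] that anticommutes with vectors anticommutes with the volume element,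
    a product of an odd number of them; this is impossible if the latter acts as
    [1] or [-1]. *)
Lemma reduced_split_odd a : odd n ->
  g (volume iota b) = 1 \/ g (volume iota b) = -1 -> reduced a ->
  exists x s, [/\ Spin h iota x, a = g x * s, reduced s & commuting s].
Proof.
move=> on hnu /reduced_factor[vs [s [hvs -> rs hs]]].
have even_vs : ~~ odd (size vs).
  apply/negP => ovs; have [[s' [ss' s's _]] _] := rs.
  have sw ws : s * g (word iota ws) = (-1) ^+ size ws *: (g (word iota ws) * s).
    elim: ws => [|w ws IH]; first by rewrite word_nil rmorph1 mulr1 mul1r scale1r.
    rewrite word_cons rmorphM /= mulrA hs -signr_odd ovs expr1 -scalerAl -(mulrA _ s) IH.
    by rewrite -scalerAr scalerA exprS mulrA.
  have := sw b; rewrite -(volume_word h) // size_tuple -signr_odd on expr1.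
  have s0 : s *+ 2 != 0.
    apply/eqP => /(congr1 (fun z => z * s')); rewrite mulrnAl ss' mul0r => /eqP.
    by rewrite -scaler_nat scaler_eq0 oner_eq0 pnatr_eq0.
  case: hnu => ->; rewrite ?mulr1 ?mul1r ?mulrN ?mulNr ?mulr1 ?mul1r scaleN1r ?opprK.
    by move/eqP; rewrite -addr_eq0 -mulr2n (negbTE s0).
  by move/eqP; rewrite eq_sym -addr_eq0 -mulr2n (negbTE s0).
exists (word iota vs), s; split=> //.
  by apply/(SpinP hC); exists vs.
by move=> v; rewrite hs -signr_odd (negbTE even_vs) scale1r.
Qed.

Hypothesis g_irreducible : forall U : {vspace S},
  (forall x, ((g x : 'End(S)) @: U <= U)%VS) -> U = 0%VS \/ U = fullv.

(** The kernel of [z - 1] is a subrepresentation.  If it is zero, [z + 1]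
    vanishes because [(z - 1) (z + 1) = 0]. *)
Lemma central_involution (z : E) : z * z = 1 ->
  (forall x, z * g x = g x * z) -> z = 1 \/ z = -1.
Proof.
move=> zz zg; pose f : E := z - 1; pose U := lker (f : 'End(S)).
have fg x : f * g x = g x * f by rewrite mulrBl mulrBr zg mul1r mulr1.
have [x|U0|U1] := g_irreducible (U := U).
- apply/subvP => _ /memv_imgP[y yU ->]; rewrite memv_ker -endo_mul_app fg.
  by move: yU; rewrite memv_ker endo_mul_app => /eqP ->; rewrite linear0.
- right; apply/eqP; rewrite -addr_eq0; apply/eqP.
  have f0 : f * (z + 1) = 0 by rewrite mulrDr mulr1 mulrBl zz mul1r addrC addrA subrK subrr.
  have f_inj : injective (f : 'End(S)) by apply/lker0P; rewrite -/U U0.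
  by apply/lfunP => x; apply: f_inj; rewrite -endo_mul_app f0 !lfunE linear0.
left; apply/eqP; rewrite -subr_eq0; apply/eqP/lfunP => x.
have : x \in U by rewrite U1 memvf.
by rewrite memv_ker => /eqP ->; rewrite lfunE.
Qed.

End Lipschitz.

(** * The type of the Schur algebra *)

Definition map_family (R : realType) (A B : algType R) (g : A -> B)
    (es : seq (R * A)) : seq (R * B) := [seq (f.1, g f.2) | f <- es].

Lemma clifford_family_map (R : realType) (A B : algType R)
    (g : {lrmorphism A -> B}) es :
  clifford_family es -> clifford_family (map_family g es).
Proof.
elim: es => //= f es IH [f1 ff fes hes]; split=> //.
- by rewrite -rmorphM /= ff lrmorph_scalar.
- by move=> _ /mapP[k kes ->] /=; rewrite -!rmorphM /= fes // rmorphN.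
exact: IH.
Qed.

Section FrobeniusSchur.
Import passmx.
Variables (R : realType) (V : vectType R) (h : {symmetric V}).
Variables (C : algType R) (iota : {linear V -> C}).
Hypothesis hC : is_clifford_algebra h iota.
Variables (n : nat) (b : n.-tuple V).
Hypothesis hb : orthonormal_basis h b.
Variables (S : vectType R) (S_proper : (0 < dim S)%N).
Local Notation E := (endo_alg S_proper).
Variable g : {lrmorphism C -> E}.

(** The matrix acts on row vectors, so products are reversed ([endo_mxM]). *)
Definition endo_mx (a : E) : 'M[R]_(\dim {:S}) :=
  mxof (vbasis {:S}) (vbasis {:S}) (a : 'End(S)).

Lemma endo_mxM a c : endo_mx (a * c) = endo_mx c *m endo_mx a.
Proof. by rewrite /endo_mx -mxof_comp // vbasisP. Qed.
Lemma endo_mx1 : endo_mx 1 = 1%:M.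
Proof. by rewrite /endo_mx mxof1 // (basis_free (vbasisP _)). Qed.
Lemma endo_mxZ r a : endo_mx (r *: a) = r *: endo_mx a.
Proof. exact: (linearZZ (mxof (vbasis {:S}) (vbasis {:S}))). Qed.
Lemma endo_mx_sum (I : Type) (r : seq I) (F : I -> E) :
  endo_mx (\sum_(i <- r) F i) = \sum_(i <- r) endo_mx (F i).
Proof. exact: (linear_sum (mxof (vbasis {:S}) (vbasis {:S}))). Qed.

Lemma endo_mx_scalar (c : R) : endo_mx c%:A = c%:M.
Proof. by rewrite endo_mxZ endo_mx1 scalemx1. Qed.

Local Notation fam := (map_family g (basis_family h iota b)).

Let famP : clifford_family fam.
Proof. exact/clifford_family_map/basis_familyP. Qed.

Variables (m : nat) (d : 'I_m -> E) (e : 'I_m -> bool).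
Hypothesis d_sqr : forall k, d k * d k = ((-1) ^+ e k)%:A.
Hypothesis d_comm : forall k l, exists s : bool,
  d k * d l = (-1) ^+ s *: (d l * d k).
(* By this every product of two distinct units is, up to sign, a unit whose
   square is -1, and such a unit is skew for the invariant form: its trace is
   zero. *)
Hypothesis d_mul : forall k l, l != k -> exists (s : bool) j,
  e j /\ d k * d l = (-1) ^+ s *: d j.
Hypothesis d_commuting : forall k, commuting iota g (d k).
Hypothesis d_span : forall a, commuting iota g a ->
  exists c : 'I_m -> R, a = \sum_k c k *: d k.

Let gens := [seq endo_mx f.2 | f <- fam] ++ [seq endo_mx (d k) | k <- enum 'I_m].
Let A := invariant_form gens.

Let d_fam k f : f \in fam -> d k * f.2 = f.2 * d k.
Proof. by move=> /mapP[_ /mapP[v _ ->] ->]; apply: d_commuting. Qed.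

Lemma sign_commuting_gens : sign_commuting gens.
Proof.
rewrite /gens; move: d_fam famP; elim: fam => [_ _|f es IH dcom /= [f1 ff fes hes]].
  elim: (enum 'I_m) => //= k ks IH; split=> //.
    by exists (e k); rewrite -endo_mxM d_sqr endo_mx_scalar.
  move=> _ /mapP[l _ ->]; have [s hs] := d_comm k l.
  by exists s; rewrite -!endo_mxM hs endo_mxZ.
split; last by apply: IH => // k u ues; apply: dcom; rewrite inE ues orbT.
  exists (f.1 < 0); rewrite -endo_mxM ff endo_mx_scalar; congr (_%:M).
  have [f0|f0|f0] := ltgtP f.1 0.
  - by rewrite expr1 -f1 ltr0_norm ?opprK.
  - by rewrite expr0 -f1 gtr0_norm.
  by move: f1; rewrite f0 normr0 => /eqP; rewrite eq_sym oner_eq0.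
move=> N; rewrite mem_cat => /orP[/mapP[u ues ->]|/mapP[k _ ->]].
  by exists true; rewrite -!endo_mxM expr1 (fes u ues) scaleN1r /endo_mx linearN opprK.
by exists false; rewrite -!endo_mxM dcom ?mem_head // scale1r.
Qed.

Let A_gens M : M \in gens -> M *m A *m M^T = A.
Proof. exact: invariant_formP sign_commuting_gens. Qed.

Lemma basis_words_invariant t : t \in basis_words fam ->
  endo_mx t.2 *m A *m (endo_mx t.2)^T = A.
Proof.
have : {subset fam <= fam} by [].
move: {1 3}fam => es; elim: es t => [|f es IH] t hes /=.
  by rewrite inE => /eqP ->; rewrite endo_mx1 mul1mx trmx1 mulmx1.
have hes' : {subset es <= fam} by move=> u ues; apply: hes; rewrite inE ues orbT.
rewrite mem_cat => /orP[/(IH _ hes')//|/mapP[s /(IH _ hes') hs ->]] /=.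
rewrite endo_mxM trmx_mul -!mulmxA (mulmxA _ A) (mulmxA (_ *m A)) hs mulmxA.
apply: A_gens; rewrite mem_cat; apply/orP; left.
by apply: map_f; apply/hes/mem_head.
Qed.

Lemma schur_type_sum :
  (\dim {:S})%:R * \sum_(t <- basis_words fam) t.1.2 =
  (size (basis_words fam))%:R * \sum_k (-1) ^+ e k.
Proof.
have S_pos : (0 < \dim {:S})%N by rewrite dimvf.
have uA : A \in unitmx := invariant_form_unit gens.
have := @frobenius_schur R (\dim {:S}) m
  [seq (t.1.2, endo_mx t.2) | t <- basis_words fam] A
  (fun k => endo_mx (d k)) (fun k => (-1) ^+ e k) S_pos uA
  (invariant_form_sym gens).
rewrite big_map size_map; apply.
- move=> _ /mapP[t ht ->] /=; have [t1 tt] := basis_words_sqr famP ht.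
  split; first exact: normr1_sqr.
    by rewrite -endo_mxM tt endo_mx_scalar.
  exact: basis_words_invariant.
- have dA k : endo_mx (d k) *m A *m (endo_mx (d k))^T = A.
    apply: A_gens; rewrite mem_cat; apply/orP; right.
    by apply: map_f; rewrite mem_enum.
  move=> k; split=> //.
  + by rewrite -expr2 sqrr_sign.
  + by rewrite -endo_mxM d_sqr endo_mx_scalar.
  move=> l lk; rewrite -endo_mxM; have [] := d_mul (k := l) (l := k).
    by rewrite eq_sym.
  move=> s [j [ej ->]]; rewrite endo_mxZ mxtraceZ.
  rewrite (mxtrace_skew uA _ (dA j)) ?mulr0 //.
  by rewrite -endo_mxM d_sqr ej endo_mx_scalar expr1 raddfN.
- move=> k _ /mapP[t ht ->] /=; rewrite -!endo_mxM; congr endo_mx.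
  have : {subset fam <= fam} by [].
  move: ht; move: {1 2}fam => es; elim: es t => [|f es IH] t /=.
    by rewrite inE => /eqP -> _; rewrite mul1r mulr1.
  move=> ht hes.
  have hes' : {subset es <= fam} by move=> u ues; apply: hes; rewrite inE ues orbT.
  move: ht; rewrite mem_cat => /orP[/IH->//|/mapP[s /IH hs ->]] /=.
  by rewrite -mulrA -d_fam ?mulrA ?hs //; apply/hes/mem_head.
move=> T; pose a := average fam (hommx (vbasis {:S}) (vbasis {:S}) T : E).
have [v|c ac] := d_span (a := a).
  have := @commutes_basis R V h C iota n b hb E g a 1 _ v.
  rewrite scale1r; apply=> i; rewrite scale1r.
  apply: (average_comm _ famP (f := (h (tnth b i) (tnth b i), g (iota (tnth b i))))).
  apply/mapP; exists (h (tnth b i) (tnth b i), iota (tnth b i)) => //.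
  by apply/mapP; exists (tnth b i) => //; apply: mem_tnth.
exists c; transitivity (endo_mx a); last first.
  by rewrite ac endo_mx_sum; apply: eq_bigr => k _; rewrite endo_mxZ.
rewrite /a average_sum // endo_mx_sum big_map; apply: eq_bigr => t _ /=.
rewrite endo_mxZ !endo_mxM mulmxA; congr (_ *: (_ *m _ *m _)).
by rewrite /endo_mx hommxK // vbasisP.
Qed.

(** The words of the family square to signs whose sum is positive for these
    signatures, so the sum of the squares of the units of the Schur algebra is
    positive as well. *)
Lemma schur_type_pos p q k :
  #|[set i | 0 < h (tnth b i) (tnth b i)]%SET| = p ->
  #|[set i | h (tnth b i) (tnth b i) < 0]%SET| = q ->
  residue p q = k%:Z -> (k < 3)%N -> 0 < \sum_k (-1) ^+ e k :> R.
Proof.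
move=> hp hq hk k3.
have := sum_basis_words (es := fam).
have -> : count (fun f => 0 < f.1) fam = p.
  by rewrite count_map -(count_positive iota hp); apply: eq_count.
have -> : count (fun f => f.1 < 0) fam = q.
  by rewrite count_map -(count_negative iota hq); apply: eq_count.
have f1 f : f \in fam -> `|f.1| = 1.
  by move=> hf; have [] := clifford_family_sqr famP hf.
move=> /(_ f1) /(congr1 (@complex.Re R)) /= hS.
have S0 : 0 < \sum_(t <- basis_words fam) t.1.2 by rewrite hS; apply: powers_Re_gt0 hk k3.
have := schur_type_sum.
have d0 : 0 < (\dim {:S})%:R :> R by rewrite ltr0n dimvf.
have := mulr_gt0 d0 S0 => /[swap] ->; rewrite pmulr_rgt0 // ltr0n.
by case: (basis_words fam) S0 => //=; rewrite big_nil ltxx.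
Qed.
End FrobeniusSchur.

Section SchurReal.
Variables (R : realType) (V : vectType R) (h : {symmetric V}).
Variables (C : algType R) (iota : {linear V -> C}).
Hypothesis hC : is_clifford_algebra h iota.
Variables (p q : nat) (b : (p + q).-tuple V).
Hypothesis hb : orthonormal_basis h b.
Hypothesis hp : #|[set i | 0 < h (tnth b i) (tnth b i)]%SET| = p.
Hypothesis hq : #|[set i | h (tnth b i) (tnth b i) < 0]%SET| = q.
Variables (S : vectType R) (S_proper : (0 < dim S)%N).
Local Notation E := (endo_alg S_proper).
Variable g : {lrmorphism C -> E}.

(** An isomorphism onto the Schur algebra, as an unpacked form of [schur_iso]. *)
Definition algebra_iso (K : lalgType R) (f : {linear K -> 'End(S)}) :=
  [/\ f 1 = 1 :> E, forall x y, f (x * y) = (f x : E) * f y :> E,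
      injective f, (forall x, commuting iota g (f x)) &
      forall a, commuting iota g a -> exists x, a = f x].

Variable k : nat.
Hypotheses (hk : residue p q = k%:Z) (k3 : (k < 3)%N).

Lemma schur_units_sum (K : lalgType R) (f : {linear K -> 'End(S)})
    m (u : 'I_m -> K) (e : 'I_m -> bool) : algebra_iso f ->
  (forall i, u i * u i = (-1) ^+ e i *: 1) ->
  (forall i j, exists s : bool, u i * u j = (-1) ^+ s *: (u j * u i)) ->
  (forall i j, j != i ->
     exists (s : bool) l, e l /\ u i * u j = (-1) ^+ s *: u l) ->
  (forall x, exists c : 'I_m -> R, x = \sum_i c i *: u i) ->
  0 < \sum_i (-1) ^+ e i :> R.
Proof.
move=> [f1 fM finj fcom fsurj] usqr ucom umul uspan.
apply: (schur_type_pos hC hb (g := g) (d := fun i => f (u i) : E) _ _ _ _ _ hp hq hk k3).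
- by move=> i; rewrite -fM usqr linearZ f1.
- by move=> i j; have [s hs] := ucom i j; exists s; rewrite -!fM hs linearZ.
- move=> i j ij; have [s [l [el hl]]] := umul i j ij; exists s, l.
  by rewrite -fM hl linearZ.
- by move=> i; apply: fcom.
move=> a /fsurj[x ->]; have [c ->] := uspan x; exists c.
by rewrite linear_sum; apply: eq_bigr => i _; rewrite linearZ.
Qed.

(** The squares of the units [1] and [i] add up to [0]. *)
Lemma schur_not_complex (f : {linear Rcomplex R -> 'End(S)}) : ~ algebra_iso f.
Proof.
move=> hf.
pose u (i : 'I_2) : Rcomplex R := if i == 0 then Complex 1 0 else Complex 0 1.
have Ceq (x y : Rcomplex R) : complex.Re x = complex.Re y ->
  complex.Im x = complex.Im y -> x = y.
  by case: x y => [? ?] [? ?] /= -> ->.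
have := @schur_units_sum _ f 2 u (fun i => i != 0) hf.
rewrite !big_ord_recl big_ord0 /= expr0 expr1 addr0 subrr ltxx.
have b2 (P : 'I_2 -> Prop) : P 0 -> P 1 -> forall i, P i.
  by move=> P0 P1 [[|[|//]] i2]; [have -> : Ordinal i2 = 0|have -> : Ordinal i2 = 1];
    rewrite //; apply: val_inj.
move=> H; suff: false by []. apply: H => {hf}.
- apply: (b2); apply: Ceq; rewrite /u /=; ring.
- by move=> i j; exists false; rewrite scale1r mulrC.
- apply: (b2); apply: (b2) => //= _; exists false, 1; split=> //.
    by apply: Ceq; rewrite /u /=; ring.
  by apply: Ceq; rewrite /u /=; ring.
move=> [x y]; exists (fun i : 'I_2 => if i == 0 then x else y).
by rewrite !big_ord_recl big_ord0 /u /=; apply: Ceq => /=; ring.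
Qed.

(** The squares of the units [1], [i], [j], [k] add up to [-2]. *)
Lemma schur_not_quat (f : {linear quat R -> 'End(S)}) : ~ algebra_iso f.
Proof.
move=> hf.
pose u (i : 'I_4) : quat R :=
  [tuple Quat 1 0 0 0; Quat 0 1 0 0; Quat 0 0 1 0; Quat 0 0 0 1]`_i.
have := @schur_units_sum _ f 4 u (fun i => i != 0) hf.
rewrite !big_ord_recl big_ord0 /= expr0 expr1.
rewrite (_ : 1 + _ = -2 :> R); last by ring.
have b4 (P : 'I_4 -> Prop) : P 0 -> P (inord 1) -> P (inord 2) -> P (inord 3) ->
    forall i, P i.
  move=> P0 P1 P2 P3 [[|[|[|[|//]]]] i4];
    [have -> : Ordinal i4 = 0|have -> : Ordinal i4 = inord 1|
     have -> : Ordinal i4 = inord 2|have -> : Ordinal i4 = inord 3] => //;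
    by apply: val_inj; rewrite /= ?inordK.
move=> H; suff: (0 : R) < -2 by rewrite oppr_gt0 ltNge ler0n.
have u0 : u 0 = Quat 1 0 0 0 by [].
have u1 : u (inord 1) = Quat 0 1 0 0 by rewrite /u inordK.
have u2 : u (inord 2) = Quat 0 0 1 0 by rewrite /u inordK.
have u3 : u (inord 3) = Quat 0 0 0 1 by rewrite /u inordK.
have n1 : (inord 1 : 'I_4) != 0 by rewrite -val_eqE /= inordK.
have n2 : (inord 2 : 'I_4) != 0 by rewrite -val_eqE /= inordK.
have n3 : (inord 3 : 'I_4) != 0 by rewrite -val_eqE /= inordK.
apply: H => {hf}.
- apply: (b4); rewrite ?u0 ?u1 ?u2 ?u3 ?eqxx ?n1 ?n2 ?n3 /= ?expr0 ?expr1;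
    congr Quat => /=; ring.
- apply: (b4); apply: (b4); rewrite ?u0 ?u1 ?u2 ?u3;
  (exists false; rewrite expr0; congr Quat => /=; ring) ||
  (exists true; rewrite expr1; congr Quat => /=; ring).
- apply: (b4); apply: (b4); rewrite ?eqxx // => _; rewrite ?u0 ?u1 ?u2 ?u3;
  (exists false, (inord 1); rewrite n1 u1 expr0; split=> //; congr Quat => /=; ring) ||
  (exists false, (inord 2); rewrite n2 u2 expr0; split=> //; congr Quat => /=; ring) ||
  (exists false, (inord 3); rewrite n3 u3 expr0; split=> //; congr Quat => /=; ring) ||
  (exists true, (inord 1); rewrite n1 u1 expr1; split=> //; congr Quat => /=; ring) ||
  (exists true, (inord 2); rewrite n2 u2 expr1; split=> //; congr Quat => /=; ring) ||
  (exists true, (inord 3); rewrite n3 u3 expr1; split=> //; congr Quat => /=; ring).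
move=> [x y z t]; exists (fun i : 'I_4 => [tuple x; y; z; t]`_i).
rewrite !big_ord_recl big_ord0 /u /=; congr Quat => /=; ring.
Qed.

End SchurReal.

(** * The real and the quaternionic cases *)

Section UnitQuaternions.
Variable R : realType.
Implicit Types x y : quat R.

Definition sqnormq x : R := qre x ^+ 2 + qi x ^+ 2 + qj x ^+ 2 + qk x ^+ 2.

Lemma sqnormq_ge0 x : 0 <= sqnormq x.
Proof. by rewrite !addr_ge0 ?sqr_ge0. Qed.

Lemma normq_sqr x : Defs.normq x ^+ 2 = sqnormq x.
Proof. by rewrite sqr_sqrtr ?sqnormq_ge0. Qed.

Lemma Sp1P x : Sp1 x <-> sqnormq x = 1.
Proof.
split=> [x1|e]; first by rewrite -normq_sqr [Defs.normq x]x1 expr1n.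
by rewrite /Sp1 /= /Defs.normq -/(sqnormq x) e sqrtr1.
Qed.

Lemma mulq_conjq x : x * conjq x = sqnormq x *: 1.
Proof. by case: x => a b c d; congr Quat => /=; rewrite /sqnormq /=; ring. Qed.

Lemma conjq_mulq x : conjq x * x = sqnormq x *: 1.
Proof. by case: x => a b c d; congr Quat => /=; rewrite /sqnormq /=; ring. Qed.

Lemma Sp1_group : is_group *%R 1 (@Sp1 R).
Proof.
split=> [|x y /Sp1P x1 /Sp1P y1|x y z _ _ _|x _|x /Sp1P x1].
- by apply/Sp1P; rewrite /sqnormq /=; ring.
- apply/Sp1P; rewrite -[RHS](mulr1 1) -{1}x1 -y1.
  by case: x y {x1 y1} => [????] [????]; rewrite /sqnormq /=; ring.
- by rewrite mulrA.
- by rewrite mul1r mulr1.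
exists (conjq x); rewrite mulq_conjq conjq_mulq x1 scale1r; split=> //.
by apply/Sp1P; rewrite -x1; case: x {x1} => ????; rewrite /sqnormq /=; ring.
Qed.

End UnitQuaternions.

Section SpinorGroups.
Variables (R : realType) (V : vectType R) (h : {symmetric V}).
Variables (C : algType R) (iota : {linear V -> C}).
Hypothesis hC : is_clifford_algebra h iota.
Variables (n : nat) (b : n.-tuple V).
Hypothesis hb : orthonormal_basis h b.
Hypothesis n_gt0 : (0 < n)%N.
Variables (S : vectType R) (S_proper : (0 < dim S)%N).
Local Notation E := (endo_alg S_proper).
Variable g : {lrmorphism C -> E}.
Variables (eps : bool) (B : {hermitian S for eps & idfun}).
Hypothesis B_nondeg : nondegenerate B.
Variable ty : bool.
Hypothesis B_adapted :
  forall v, is_transpose B (g (iota v)) ((-1) ^+ ty *: g (iota v)).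
Local Notation red := (reduced iota g B).

Lemma commuting_word (s : E) vs : commuting iota g s ->
  s * g (word iota vs) = g (word iota vs) * s.
Proof.
move=> hs; elim: vs => [|v vs IH]; first by rewrite word_nil rmorph1 mulr1 mul1r.
by rewrite word_cons rmorphM /= mulrA hs -mulrA IH mulrA.
Qed.

Lemma scalar_reduced (c : R) : red c%:A -> c = 1 \/ c = -1.
Proof. by move=> [_ [r r1 /similitude_scalar_unit]]; apply. Qed.

Section RealType.
Hypothesis schur_real : forall s, commuting iota g s -> exists c : R, s = c%:A.

Lemma real_iso (G : set C) :
  is_group *%R 1 G -> G `<=` Pin h iota -> (forall x, G x -> G (- x)) ->
  (forall a, red a -> exists x s, [/\ G x, a = g x * s, red s &
     commuting iota g s]) ->
  (forall x, G x -> commuting iota g (g x) -> x = 1 \/ x = -1) ->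
  group_iso *%R 1 G *%R 1 red g.
Proof.
move=> hG GPin GN surj ker; apply: group_iso_kernel => //.
- exact: (reduced_group hC hb g B).
- by move=> x y _ _; rewrite rmorphM.
- by move=> x /GPin; apply: (reduced_Pin hC B_nondeg B_adapted).
- move=> a /surj[x [s [Gx -> rs /schur_real[c ec]]]]; rewrite ec in rs *.
  have [->|->] := scalar_reduced rs; first by exists x; rewrite ?scale1r ?mulr1.
  by exists (- x); [exact: GN|rewrite scaleN1r mulrN1 rmorphN].
move=> x Gx gx1; have [|//|x1] := ker x Gx.
  by move=> v; rewrite gx1 mulr1 mul1r.
move: gx1; rewrite x1 rmorphN rmorph1 => /eqP; rewrite -subr_eq0 -opprD.
by rewrite oppr_eq0 -mulr2n -scaler_nat scaler_eq0 oner_eq0 pnatr_eq0.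
Qed.

End RealType.

Section QuaternionicType.
Variable f : {linear quat R -> 'End(S)}.
Hypothesis hf : algebra_iso iota g f.
Variable c : 'End(S) -> 'End(S).
Hypothesis cf : forall x, (c (f x) : E) * f x = (sqnormq x)%:A.
Hypothesis ct : forall x, is_transpose B (f x) (c (f x)).

Let f1 : f 1 = 1 :> E. Proof. by case: hf. Qed.
Let fM x y : f (x * y) = (f x : E) * f y :> E. Proof. by case: hf. Qed.

(** The transpose of [f y] is the image of the conjugate of [y], so the norm of
    [f y] is the squared norm of [y]; being nonnegative, it has modulus one only
    if it is one. *)
Lemma quat_reduced y : Sp1 y <-> red (f y).
Proof.
have sim_f : similitude (S_proper := S_proper) B (f y) (sqnormq y).
  by apply/(similitude_transpose B_nondeg _ (ct y)).
split=> [/Sp1P y1|[_ [r r1 hr]]].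
  have fV : (f y : E) * f (conjq y) = 1 by rewrite -fM mulq_conjq y1 scale1r f1.
  have Vf : (f (conjq y) : E) * f y = 1 by rewrite -fM conjq_mulq y1 scale1r f1.
  have fcom v : (f y : E) * g (iota v) = 1 *: (g (iota v) * (f y : E)).
    by rewrite scale1r; case: hf => _ _ _ + _; apply.
  by apply: (signed_reduced fV Vf fcom sim_f); rewrite y1 normr1.
apply/Sp1P.
have : r%:A = (sqnormq y)%:A :> E.
  by rewrite -(proj1 (similitude_transpose B_nondeg _ (ct y)) hr) cf.
by move=> /scalar_inj e; rewrite -r1 e ger0_norm ?sqnormq_ge0.
Qed.

(** If [g x f y = 1] then [g x] is in the Schur algebra, so [x] is [1] or [-1]
    by hypothesis and [y] follows. *)
Lemma quat_dot_iso (G : set C) :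
  is_group *%R 1 G -> G `<=` Pin h iota ->
  (forall a, red a -> exists x s, [/\ G x, a = g x * s, red s &
     commuting iota g s]) ->
  (forall x, G x -> commuting iota g (g x) -> x = 1 \/ x = -1) ->
  exists phi : set (C * quat R) -> E,
    (forall x y, phi (pmcoset (x, y)) = g x * f y) /\
    group_iso (@mulset _) (pmcoset 1) (dotgroup G (@Sp1 R)) *%R 1 red phi.
Proof.
move=> hG GPin surj ker; have [_ _ finj fcom fsurj] := hf.
apply: dotgroup_iso => //.
- exact: Sp1_group.
- exact: (reduced_group hC hb g B).
- by move=> x; rewrite rmorphN.
- by move=> y; rewrite linearN.
- by move=> x y _ _; rewrite rmorphM.
- by move=> x y /GPin/(PinP hC)[vs _ ->] _; rewrite (commuting_word _ (fcom y)).
- move=> x y /GPin px /quat_reduced ry; apply: reducedM => //.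
  exact: (reduced_Pin hC B_nondeg B_adapted px).
- move=> a /surj[x [s [Gx -> rs /fsurj[y ey]]]]; rewrite ey in rs *.
  by exists x, y; split=> //; apply/quat_reduced.
move=> x y Gx /Sp1P y1 e.
have fyV : (f y : E) * f (conjq y) = 1 by rewrite -fM mulq_conjq y1 scale1r f1.
have gx : g x = f (conjq y) by rewrite -[LHS]mulr1 -fyV mulrA e mul1r.
have hx : commuting iota g (g x) by rewrite gx; apply: fcom.
move: e; case: (ker x Gx hx) => ->; [left|right]; split=> //; apply: finj.
  by move: e; rewrite rmorph1 mul1r f1.
by move: e; rewrite rmorphN rmorph1 mulN1r linearN f1 => <-; rewrite opprK.
Qed.

End QuaternionicType.
End SpinorGroups.

(** * The Clifford algebra of a definite plane *)

Lemma vect_separated (R : realType) (W : vectType R) (z : W) :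
  (forall l : {scalar W}, l z = 0) -> z = 0.
Proof.
move=> hz; rewrite (coord_vbasis (memvf z)); apply: big1 => i _.
by rewrite (hz (coord (vbasis {:W}) i)) scale0r.
Qed.

Section PlaneClifford.
Variables (R : realType) (a : R).
Hypothesis aa : a * a = 1.
Variables (C2 : algType R) (iota2 : {linear 'rV[R]_2 -> C2}).
Hypothesis hC2 : is_clifford_algebra (form2 a) iota2.
Local Notation e1 := (iota2 (delta_mx 0 0)).
Local Notation e2 := (iota2 (delta_mx 0 1)).

Definition plane_vector (x y : R) : 'rV[R]_2 := x *: delta_mx 0 0 + y *: delta_mx 0 1.

Lemma plane_vectorE (v : 'rV[R]_2) : v = plane_vector (v 0 0) (v 0 1).
Proof.
apply/rowP => -[[|[|//]] i]; rewrite !mxE /=.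
  by rewrite mulr1 mulr0 addr0; congr (v _ _); apply: val_inj.
by rewrite mulr1 mulr0 add0r; congr (v _ _); apply: val_inj.
Qed.

Lemma iota2_plane x y : iota2 (plane_vector x y) = x *: e1 + y *: e2.
Proof. by rewrite linearD !linearZ. Qed.

Lemma form2_plane x y :
  form2 a (plane_vector x y) (plane_vector x y) = a * (x ^+ 2 + y ^+ 2).
Proof. by rewrite /form2 !mxE /= !mulr1 !mulr0 addr0 add0r !expr2. Qed.

Lemma iota2_sqr x y : (x *: e1 + y *: e2) * (x *: e1 + y *: e2) =
  (a * (x ^+ 2 + y ^+ 2))%:A.
Proof. by rewrite -iota2_plane (clifford_sqr hC2) form2_plane. Qed.

Lemma e1_sqr : e1 * e1 = a%:A.
Proof.
have := iota2_sqr 1 0; rewrite scale1r scale0r addr0 => ->; congr (_ *: _); ring.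
Qed.

Lemma e2_sqr : e2 * e2 = a%:A.
Proof.
have := iota2_sqr 0 1; rewrite scale1r scale0r add0r => ->; congr (_ *: _); ring.
Qed.

Lemma e2e1 : e2 * e1 = - (e1 * e2).
Proof.
have := iota2_sqr 1 1; rewrite !scale1r mulrDl !mulrDr e1_sqr e2_sqr.
rewrite expr1n mulr1.
move=> e; apply/eqP; rewrite -addr_eq0 addrC; apply/eqP.
apply: (addrI (a%:A + a%:A)); rewrite addr0 -[RHS]scalerDl -e addrACA.
by congr (_ + _); rewrite addrC.
Qed.

Lemma e12_sqr : (e1 * e2) * (e1 * e2) = -1.
Proof.
rewrite mulrA -(mulrA e1) e2e1 mulrN mulrA e1_sqr mulNr -mulrA e2_sqr.
by rewrite scalarM aa scale1r.
Qed.

Lemma plane_span z : exists x y s t : R,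
  z = x%:A + y *: (e1 * e2) + (s *: e1 + t *: e2).
Proof.
pose es : seq (R * C2) := [:: (a, e1); (a, e2)].
have a1 := sqr1_normr aa.
have fam : clifford_family es.
  split=> //=; [exact: e1_sqr| |split=> //; exact: e2_sqr].
  by move=> f; rewrite inE => /eqP -> /=; rewrite e2e1.
have gword vs : graded_span es (odd (size vs)) (word iota2 vs).
  elim/last_ind: vs => [|vs v IH]; first by rewrite word_nil; exact: graded_span1.
  rewrite -cats1 word_cat word_seq1 size_cat addn1 oddS (plane_vectorE v) iota2_plane.
  rewrite mulrDr -!scalerAr.
  apply: graded_spanD; apply: graded_spanZ.
    by apply: (graded_span_mul (f := (a, e1))) => //; rewrite inE eqxx.
  by apply: (graded_span_mul (f := (a, e2))) => //; rewrite !inE eqxx orbT.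
have gall b w : graded_span es b w -> exists x y s t : R,
    w = x%:A + y *: (e1 * e2) + (s *: e1 + t *: e2).
  case: b => /= -[_ [_ [[y1 [z1 [h1 h2 ->]]] [y2 [z2 [k1 k2 ->]]] ->]]].
    case: h2 => c ->; case: k1 => d ->; rewrite h1 k2.
    exists 0, 0, d, c; rewrite !scale0r !add0r mul0r addr0.
    by rewrite -!scalerAl !mul1r addrC.
  case: h1 => c ->; case: k2 => d ->; rewrite h2 k1.
  exists c, (- d), 0, 0; rewrite !scale0r !addr0 mul0r add0r addr0.
  by rewrite -!scalerAl mul1r e2e1 scalerN scaleNr.
have [ws ->] := clifford_word_span hC2 z.
elim: ws => [|w ws [x [y [s [t IH]]]]].
  by exists 0, 0, 0, 0; rewrite big_nil !scale0r !addr0.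
have [x' [y' [s' [t' e]]]] := gall _ _ (gword w.2).
exists (w.1 * x' + x), (w.1 * y' + y), (w.1 * s' + s), (w.1 * t' + t).
rewrite big_cons IH e !scalerDr !scalerA !scalerDl.
by rewrite addrACA; congr (_ + _); rewrite addrACA.
Qed.

(** The rotation is the product of [e1] and the unit vector
    [a x e1 + y e2]. *)
Lemma Pin_rotation x y : x ^+ 2 + y ^+ 2 = 1 ->
  Pin (form2 a) iota2 (x%:A + y *: (e1 * e2)).
Proof.
move=> xy; have a1 := sqr1_normr aa.
have -> : x%:A + y *: (e1 * e2) =
    iota2 (plane_vector 1 0) * iota2 (plane_vector (a * x) y).
  rewrite !iota2_plane scale1r scale0r addr0 mulrDr -!scalerAr e1_sqr scalerA.
  by rewrite mulrAC aa mul1r.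
apply: generated_mul; apply: generated_in; (eexists; last reflexivity) => /=;
  rewrite form2_plane normrM a1 mul1r.
  by rewrite expr1n expr0n /= addr0 normr1.
by rewrite exprMn [a ^+ 2]expr2 aa mul1r xy normr1.
Qed.

Lemma Pin_e1 : Pin (form2 a) iota2 e1.
Proof.
apply: generated_in; exists (delta_mx 0 0) => //=.
have -> : delta_mx 0 0 = plane_vector 1 0 by rewrite /plane_vector scale1r scale0r addr0.
by rewrite form2_plane expr1n expr0n /= addr0 mulr1 sqr1_normr.
Qed.

Section PlaneRepresentation.
Variables (E : algType R) (u J : E).
Hypotheses (uu : u * u = a%:A) (JJ : J * J = -1) (uJ : u * J = - (J * u)).

Lemma complex_mul x y s t : (x%:A + y *: J) * (s%:A + t *: J) =
  (x * s - y * t)%:A + (x * t + y * s) *: J.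
Proof.
rewrite mulrDl !mulrDr -!scalerAl -!scalerAr !mul1r !mulr1 JJ !scalerA scalerN.
by rewrite scalerBl scalerDl [X in _ + X = _]addrC addrACA.
Qed.

Lemma complex_scalar_eq0 x y : x%:A + y *: J = 0 -> x = 0 /\ y = 0.
Proof.
move=> e; have : (x%:A + y *: J) * (x%:A + (- y) *: J) = 0 by rewrite e mul0r.
rewrite complex_mul (_ : x * - y + y * x = 0); last by ring.
rewrite scale0r addr0 => /eqP; rewrite scaler_eq0 oner_eq0 orbF mulrN opprK.
rewrite -!expr2 paddr_eq0 ?sqr_ge0 // !sqrf_eq0.
by move=> /andP[/eqP -> /eqP ->].
Qed.

(** As [e1] goes to [u] and [e1 e2] should go to [J], the image of [e2] is the
    inverse of [u] times [J], and the inverse of [u] is [a *: u]. *)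
Definition plane_rep (v : 'rV[R]_2) : E := v 0 0 *: u + v 0 1 *: (a *: (u * J)).

Fact plane_rep_linear : linear plane_rep.
Proof.
move=> k v w; rewrite /plane_rep !mxE !scalerDl !scalerDr !scalerA.
by rewrite addrACA; congr (_ + _ + (_ *: _ + _)); rewrite mulrA.
Qed.

Lemma plane_rep_sqr v : plane_rep v * plane_rep v = (form2 a v v)%:A.
Proof.
have uJuJ : (u * J) * (u * J) = a%:A.
  by rewrite {1}uJ mulNr -mulrA (mulrA u u) uu -scalerAl mul1r -scalerAr JJ scalerN opprK.
have uuJ : u * (u * J) + (u * J) * u = 0.
  by rewrite {2}uJ mulNr -!mulrA mulrA uu -scalerAl mul1r -scalerAr mulr1 subrr.
rewrite /plane_rep; set x := v 0 0; set y := v 0 1.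
rewrite mulrDl !mulrDr -!scalerAl -!scalerAr uJuJ uu !scalerA.
rewrite addrACA addrA addrAC -addrA.
have -> : (y * a * x) *: (u * J * u) = - (x * (y * a)) *: (u * (u * J)).
  move/eqP: uuJ; rewrite addrC addr_eq0 => /eqP ->.
  by rewrite scalerN scaleNr; congr (- (_ *: _)); ring.
rewrite addrACA -!scalerDl addNr scale0r addr0 /form2; congr (_ *: _).
rewrite -[LHS]/(_ * _); transitivity (x * x * a + y * y * a * (a * a)); first by ring.
by rewrite aa /x /y; ring.
Qed.

Lemma plane_rep_exists : exists rho : {lrmorphism C2 -> E},
  [/\ forall v, rho (iota2 v) = plane_rep v, rho e1 = u & rho (e1 * e2) = J].
Proof.
pose F : {linear 'rV[R]_2 -> E} := HB.pack plane_rep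
  (GRing.isLinear.Build R 'rV[R]_2 E *:%R plane_rep plane_rep_linear).
have [rho hrho _] := clifford_univ hC2 (f := F) plane_rep_sqr.
have r1 : rho e1 = u.
  by rewrite hrho /= /plane_rep !mxE /= scale1r scale0r addr0.
exists rho; split=> //; rewrite rmorphM /= r1 hrho /= /plane_rep !mxE /=.
by rewrite scale1r scale0r add0r -scalerAr mulrA uu -scalerAl mul1r scalerA aa scale1r.
Qed.

Variable rho : {lrmorphism C2 -> E}.
Hypotheses (rhoE : forall v, rho (iota2 v) = plane_rep v) (rho_e1 : rho e1 = u).
Hypothesis rho_e12 : rho (e1 * e2) = J.

Lemma rho_span x y s t :
  rho (x%:A + y *: (e1 * e2) + (s *: e1 + t *: e2)) =
  x%:A + y *: J + u * (s%:A + (t * a) *: J).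
Proof.
rewrite !linearD !linearZ /= rho_e12 rho_e1 rmorph1 rhoE /plane_rep !mxE /=.
by rewrite scale1r scale0r add0r mulrDr -!scalerAr mulr1 scalerA.
Qed.

(** The even part of [rho z] commutes with [J] and the odd part anticommutes with
    it, so the commutator with [J] isolates the odd part. *)
Lemma rho_even_odd z : exists x y s t,
  [/\ z = x%:A + y *: (e1 * e2) + (s *: e1 + t *: e2),
      rho z = x%:A + y *: J + u * (s%:A + (t * a) *: J) &
      J * rho z - rho z * J = - (2 *: (u * (s%:A + (t * a) *: J) * J))].
Proof.
have [x [y [s [t ez]]]] := plane_span z; exists x, y, s, t.
have Jc (p q : R) : J * (p%:A + q *: J) = (p%:A + q *: J) * J.
  by rewrite mulrDl mulrDr -!scalerAl -!scalerAr mul1r mulr1.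
have Ju : J * u = - (u * J) by rewrite uJ opprK.
split=> //; rewrite ez rho_span //.
have := Jc x y; have := Jc s (t * a).
move: (x%:A + y *: J) (s%:A + (t * a) *: J) => P Q JQ JP.
rewrite mulrDr mulrDl JP opprD addrACA subrr add0r (mulrA J u) Ju mulNr -(mulrA u J) JQ.
by rewrite mulrA -opprD scaler_nat mulr2n.
Qed.

Lemma rho_inj : injective rho.
Proof.
move=> z z' ezz; apply/eqP; rewrite -subr_eq0; apply/eqP.
have : rho (z - z') = 0 by rewrite linearB /= ezz subrr.
move: (z - z') => {ezz z'}z rz.
have [x [y [s [t [ez e1z]]]]] := rho_even_odd z.
rewrite rz mulr0 mul0r subr0 => /esym/eqP; rewrite oppr_eq0 scaler_eq0 pnatr_eq0 /=.
move=> /eqP uQJ; have st : s%:A + (t * a) *: J = 0.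
  move: (congr1 (fun w => - a *: (u * w * J)) uQJ) => /=.
  move: (s%:A + (t * a) *: J) => Q.
  rewrite mulr0 mul0r scaler0 (mulrA u (u * Q)) (mulrA u u) uu.
  by rewrite -mulrA JJ mulrN1 scalerN scaleNr opprK -scalerAl mul1r scalerA aa scale1r.
have [s0 ta0] := complex_scalar_eq0 st.
have t0 : t = 0 by rewrite -[t]mulr1 -aa mulrA ta0 mul0r.
move: e1z; rewrite rz st mulr0 addr0 => /esym/complex_scalar_eq0[x0 y0].
by rewrite ez x0 y0 s0 t0 !scale0r !addr0.
Qed.

End PlaneRepresentation.
End PlaneClifford.

(** * The complex case *)

Section ComplexType.
Variables (R : realType) (V : vectType R) (h : {symmetric V}).
Variables (C : algType R) (iota : {linear V -> C}).
Hypothesis hC : is_clifford_algebra h iota.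
Variables (n : nat) (b : n.-tuple V).
Hypothesis hb : orthonormal_basis h b.
Hypothesis n_gt0 : (0 < n)%N.
Hypothesis n_odd : odd n.
Variables (S : vectType R) (S_proper : (0 < dim S)%N).
Local Notation E := (endo_alg S_proper).
Variable g : {lrmorphism C -> E}.
Variables (eps : bool) (B : {hermitian S for eps & idfun}).
Hypothesis B_nondeg : nondegenerate B.
Variable ty : bool.
Hypothesis B_adapted :
  forall v, is_transpose B (g (iota v)) ((-1) ^+ ty *: g (iota v)).
Local Notation red := (reduced iota g B).

Local Notation nu := (volume iota b).
Local Notation J := (g nu).
Variables (a : R) (u : E).
Hypothesis aa : a * a = 1.
Hypotheses (uu : u * u = a%:A) (JJ : J * J = -1).
Hypothesis u_anti : forall v, u * g (iota v) = - (g (iota v) * u).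
Hypothesis schur_complex : forall s, commuting iota g s ->
  exists x y : R, s = x%:A + y *: J.
Hypothesis anti_span : forall s : E,
  (forall v, s * g (iota v) = - (g (iota v) * s)) ->
  exists2 t, commuting iota g t & s = t * u.
Hypothesis u_sim : similitude B u 1.
Hypothesis J_transpose : is_transpose B J (- J).

Lemma volume_commuting : commuting iota g J.
Proof.
by move=> v; rewrite -!rmorphM /= (volume_central hC hb _ n_gt0 n_odd).
Qed.

Lemma anti_word ws : u * g (word iota ws) = (-1) ^+ size ws *: (g (word iota ws) * u).
Proof.
elim: ws => [|w ws IH]; first by rewrite word_nil rmorph1 mulr1 mul1r scale1r.
rewrite word_cons rmorphM /= mulrA u_anti mulNr -(mulrA _ u) IH -scalerAr -scaleNr.
by rewrite exprS mulN1r mulrA.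
Qed.

Lemma uJ_anti : u * J = - (J * u).
Proof.
by rewrite (volume_word h) // anti_word size_tuple -signr_odd n_odd scaleN1r.
Qed.

Lemma u_inv : u * (a *: u) = 1 /\ (a *: u) * u = 1.
Proof. by rewrite -scalerAl -scalerAr uu scalerA aa scale1r. Qed.

Lemma complex_app x y (s : S) :
  ((x%:A + y *: J : E) : 'End(S)) s = x *: s + y *: (J : 'End(S)) s.
Proof. by rewrite add_lfunE !scale_lfunE; congr (_ *: _ + _); rewrite lfunE. Qed.

Lemma complex_similitude x y : similitude B (x%:A + y *: J : E) (x ^+ 2 + y ^+ 2).
Proof.
apply/(similitude_transpose (a' := x%:A + (- y) *: J) B_nondeg).
  move=> s t; rewrite !complex_app !(pairingDl, pairingDr) !(pairingZl, pairingZr) J_transpose.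
  by rewrite [((- J : E) : 'End(S)) t]opp_lfunE pairingNr mulrN mulNr.
rewrite complex_mul // (_ : x * y + - y * x = 0); last by ring.
by rewrite scale0r addr0 mulNr opprK -!expr2.
Qed.

Lemma complex_reduced x y : red (x%:A + y *: J) <-> x ^+ 2 + y ^+ 2 = 1.
Proof.
split=> [[_ [r r1 hr]]|xy].
  have hs := complex_similitude x y.
  have [s [t st]] := form_neq0 S_proper B_nondeg.
  have : r = x ^+ 2 + y ^+ 2 by apply: (mulIf st); rewrite -hr -hs.
  by move=> e; rewrite -r1 e ger0_norm // addr_ge0 ?sqr_ge0.
have Jcom := volume_commuting.
apply: (signed_reduced (s' := x%:A + (- y) *: J) (c := 1)
  _ _ _ (complex_similitude x y)); last by rewrite xy normr1.
- rewrite complex_mul // mulrN opprK -!expr2 xy scale1r.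
  by rewrite (_ : x * - y + y * x = 0) ?scale0r ?addr0 //; ring.
- rewrite complex_mul // mulNr opprK -!expr2 xy scale1r.
  by rewrite (_ : x * y + - y * x = 0) ?scale0r ?addr0 //; ring.
move=> v; rewrite scale1r mulrDl mulrDr -!scalerAl -!scalerAr mul1r mulr1.
by rewrite Jcom.
Qed.

Lemma u_reduced : red u.
Proof.
have [uV Vu] := u_inv.
apply: (signed_reduced (c := -1) uV Vu _ u_sim); rewrite ?normr1 // => v.
by rewrite scaleN1r.
Qed.

Variables (C2 : algType R) (iota2 : {linear 'rV[R]_2 -> C2}).
Hypothesis hC2 : is_clifford_algebra (form2 a) iota2.
Local Notation e1 := (iota2 (delta_mx 0 0)).
Local Notation e2 := (iota2 (delta_mx 0 1)).

Section Rho.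
Variable rho : {lrmorphism C2 -> E}.
Hypotheses (rhoE : forall v, rho (iota2 v) = plane_rep a u J v) (rho_e1 : rho e1 = u).
Hypothesis rho_e12 : rho (e1 * e2) = J.

Lemma rho_rotation x y : rho (x%:A + y *: (e1 * e2)) = x%:A + y *: J.
Proof. by rewrite linearD !linearZ /= rmorph1 rho_e12. Qed.

(** The image of the vector [(x, y)] is [u] times [x + a y J], a rotation for a
    unit vector. *)
Lemma rho_reduced y : Pin (form2 a) iota2 y -> red (rho y).
Proof.
move=> /(PinP hC2)[vs hvs ->]; elim: vs hvs => [|v vs IH] hvs.
  by rewrite word_nil rmorph1; apply: reduced1.
rewrite word_cons rmorphM /=; apply: reducedM; last first.
  by apply: IH => w hw; apply/hvs/mem_behead.
have -> : rho (iota2 v) = u * ((v 0 0)%:A + (v 0 1 * a) *: J).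
  by rewrite rhoE /plane_rep mulrDr -!scalerAr mulr1 scalerA.
apply: reducedM; first exact: u_reduced.
apply/complex_reduced; rewrite exprMn [a ^+ 2]expr2 aa mulr1.
have := hvs v (mem_head _ _); rewrite /form2 normrM -!expr2 (sqr1_normr aa).
by rewrite mul1r ger0_norm // addr_ge0 ?sqr_ge0.
Qed.

(** An even word commutes with [u], which anticommutes with each of its letters,
    and with the central [J]; the image of [rho] is generated by these. *)
Lemma Spin_rho_comm x y : Spin h iota x -> g x * rho y = rho y * g x.
Proof.
move=> /(SpinP hC)[vs [_ ev ->]].
have gu : u * g (word iota vs) = g (word iota vs) * u.
  by rewrite anti_word -signr_odd (negbTE ev) scale1r.
have gJ : J * g (word iota vs) = g (word iota vs) * J.
  exact: commuting_word volume_commuting.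
have grep v : g (word iota vs) * rho (iota2 v) = rho (iota2 v) * g (word iota vs).
  rewrite rhoE /plane_rep mulrDl mulrDr -!scalerAl -!scalerAr gu.
  by rewrite -(mulrA u) gJ (mulrA u) gu !mulrA.
have [ws ->] := clifford_word_span hC2 y.
rewrite linear_sum mulr_sumr mulr_suml; apply: eq_bigr => w _.
rewrite linearZ /= -scalerAr -scalerAl; congr (_ *: _).
elim: w.2 => [|v vs' IH]; first by rewrite word_nil rmorph1 mulr1 mul1r.
by rewrite word_cons rmorphM /= mulrA grep -(mulrA _ (g _)) IH mulrA.
Qed.

Lemma complex_surjective s : red s -> commuting iota g s ->
  exists2 y, Pin (form2 a) iota2 y & s = rho y.
Proof.
move=> rs /schur_complex[x [y es]]; rewrite es in rs *.
exists (x%:A + y *: (e1 * e2)); last by rewrite rho_rotation.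
exact/(Pin_rotation aa hC2)/complex_reduced.
Qed.

(** An odd word is made even by the volume element, which is a product of an odd
    number of vectors; its inverse [- J] joins the factor [s], which still
    anticommutes with vectors and so is a multiple of [u]. *)
Lemma Spin_rho_surjective k : red k ->
  exists x y, [/\ Spin h iota x, Pin (form2 a) iota2 y & k = g x * rho y].
Proof.
move=> /(reduced_factor hC hb B_nondeg B_adapted)[vs [s [hvs -> rs hs]]].
have [even_vs|odd_vs] := boolP (~~ odd (size vs)).
  have [|y py ->] := complex_surjective rs.
    by move=> v; rewrite hs -signr_odd (negbTE even_vs) scale1r.
  by exists (word iota vs), y; split=> //; apply/(SpinP hC); exists vs.
have JN : J * (- J) = 1 by rewrite mulrN JJ opprK.
have rJ : red (- J).
  rewrite -[- J](add0r) -(scale0r 1) -scaleN1r; apply/complex_reduced.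
  by rewrite expr0n /= add0r sqrrN expr1n.
have Jcom := volume_commuting.
have rNJs : red (- J * s) by apply: reducedM.
have [|t tcom et] := anti_span (s := - J * s).
  move=> v; rewrite -mulrA hs -signr_odd (negbNE odd_vs) scaleN1r mulrN.
  by rewrite !mulNr mulrN !opprK (mulrA J) Jcom mulrA.
have rt : red t.
  have [uV Vu] := u_inv.
  have -> : t = (- J * s) * (a *: u) by rewrite et -mulrA uV mulr1.
  by apply: reducedM => //; apply: (reducedV hC hb u_reduced uV Vu).
have [y py ey] := complex_surjective rt tcom.
exists (word iota vs * nu), (y * e1); split.
- apply/(SpinP hC); exists (vs ++ b); rewrite word_cat -(volume_word h) // size_cat.
  split=> //; last by rewrite size_tuple oddD n_odd (negbNE odd_vs).
  by apply: unit_vectors_cat => //; apply: unit_vectors_basis.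
- by apply: generated_mul => //; apply: Pin_e1.
by rewrite !rmorphM /= rho_e1 -ey -et mulrA -(mulrA (g _)) JN mulr1.
Qed.

(** The inverse of [rho y] is [g x], which commutes with [J]; so [rho y] is even,
    that is, in the Schur algebra, and then so is [g x]. *)
Lemma Spin_rho_kernel x y : Spin h iota x -> Pin (form2 a) iota2 y ->
  g x * rho y = 1 -> (x = 1 /\ y = 1) \/ (x = -1 /\ y = -1).
Proof.
move=> sx py e; have e' : rho y * g x = 1 by rewrite -Spin_rho_comm.
have Jcom := volume_commuting.
have xJ : J * g x = g x * J.
  by move: sx => /(SpinP hC)[vs [_ _ ->]]; apply: commuting_word Jcom.
have yJ : J * rho y = rho y * J.
  by rewrite -[LHS]mul1r -e' -!mulrA (mulrA _ J) -xJ -mulrA e mulr1.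
have [x1 [y1 [s [t [_ ey]]]]] := rho_even_odd aa hC2 uJ_anti rhoE rho_e1 rho_e12 y.
rewrite yJ subrr => /esym/eqP; rewrite oppr_eq0 scaler_eq0 pnatr_eq0 /= => /eqP Q0.
have cancelJ (Q : E) : Q * J = 0 -> Q = 0.
  by move=> QJ; rewrite -[Q]mulr1 -(opprK 1) -JJ mulrN mulrA QJ mul0r oppr0.
have {}Q0 := cancelJ _ Q0.
have ycom : commuting iota g (rho y).
  move=> v; rewrite ey Q0 addr0 mulrDl mulrDr -!scalerAl -!scalerAr mul1r mulr1.
  by rewrite Jcom.
have xcom : commuting iota g (g x).
  move=> v; rewrite -[LHS]mulr1 -e' !mulrA -(mulrA (g x)).
  by rewrite -ycom mulrA e mul1r.
move: e; case: (Spin_kernel hC hb n_gt0 B_nondeg B_adapted sx xcom) => ->; [left|right];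
  split=> //; apply: (rho_inj aa hC2 uu JJ uJ_anti rhoE rho_e1 rho_e12).
  by move: e; rewrite !rmorph1 mul1r.
by move: e; rewrite rmorphN rmorph1 mulN1r rmorphN rmorph1 => <-; rewrite opprK.
Qed.

(** Linear forms of the endomorphism space pull back along the injective
    [rho]. *)
Lemma plane_separated z : (forall l : {scalar C2}, l z = 0) -> z = 0.
Proof.
move=> hz; apply: (rho_inj aa hC2 uu JJ uJ_anti rhoE rho_e1 rho_e12).
rewrite rmorph0; apply: (@vect_separated R 'End(S)) => l.
pose f (w : C2) : R := l (rho w).
have fL : linear (f : C2 -> R^o) by move=> k v w; rewrite /f !linearP.
exact: (hz (HB.pack f (GRing.isLinear.Build R C2 R^o *%R f fL))).
Qed.

End Rho.

Theorem Spin_o_iso : exists phi : set (C * C2) -> E,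
  (forall x (t : R) (k : bool), Spin h iota x ->
     phi (pmcoset (x, expA *%R 1 (t *: (e1 * e2)) * e1 ^+ k)) =
     g x * expA *%R (1 : E) (t *: J) * (if k then u else 1)) /\
  group_iso (@mulset _) (pmcoset 1) (dotgroup (Spin h iota) (Pin (form2 a) iota2))
    *%R 1 red phi.
Proof.
have [rho [rhoE rho_e1 rho_e12]] := plane_rep_exists aa hC2 uu JJ uJ_anti.
have [|||x|y|x y _ _|x y _ _|x y sx _|x y sx py|k|x y|phi [phiE hphi]] :=
  dotgroup_iso (G1 := Spin h iota) (G2 := Pin (form2 a) iota2) (K := red)
    (f1 := g) (f2 := rho).
- exact: Spin_group.
- exact: Pin_group.
- exact: (reduced_group hC hb g B).
- by rewrite rmorphN.
- by rewrite rmorphN.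
- by rewrite rmorphM.
- by rewrite rmorphM.
- exact: Spin_rho_comm rhoE _ _ sx.
- apply: reducedM; first exact: (reduced_Spin hC B_nondeg B_adapted).
  exact: (rho_reduced rhoE).
- exact: (Spin_rho_surjective rho_e1 rho_e12).
- exact: (Spin_rho_kernel rhoE rho_e1 rho_e12).
exists phi; split=> // x t k sx; rewrite phiE rmorphM /=.
rewrite (expA_rotation (e12_sqr aa hC2)); last exact: (plane_separated rhoE rho_e1 rho_e12).
rewrite (expA_rotation JJ); last by move=> z; apply: (@vect_separated R 'End(S)).
rewrite (rho_rotation rho_e12) (mulrA (g x)) rmorphXn /= rho_e1.
by case: k; rewrite ?expr1 ?expr0.
Qed.

End ComplexType.

(** * Assembling the five cases *)

Section Bridge.
Variables (R : realType) (V : vectType R) (h : {symmetric V}).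
Variables (C : algType R) (iota : {linear V -> C}).
Variables (S : vectType R) (S_proper : (0 < dim S)%N).
Local Notation E := (endo_alg S_proper).
Variables (gamma : {linear C -> 'End(S)}) (g : {lrmorphism C -> E}).
Hypothesis gE : forall x, g x = gamma x.
Variables (eps : bool) (B : {hermitian S for eps & idfun}).
Hypothesis B_nondeg : nondegenerate B.

Lemma schur_algebraE (s : E) :
  schur_algebra iota gamma s <-> commuting iota g s.
Proof.
split=> [hs v|hs _ [v _ <-]]; first by rewrite gE; apply: hs; exists v.
by have := hs v; rewrite gE.
Qed.

Lemma schur_iso_algebra (K : lalgType R) (f : {linear K -> 'End(S)}) :
  schur_iso iota gamma f -> algebra_iso iota g f.
Proof.
move=> [f1 fM [fin finj fsurj]]; split=> //.
- by move=> x y /finj; rewrite !in_setT; apply.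
- by move=> x; apply/schur_algebraE/fin.
by move=> a /schur_algebraE/fsurj[x _ <-]; exists x.
Qed.

Lemma reduced_lipschitz_groupE :
  reduced_lipschitz_group iota gamma B = reduced iota g B.
Proof.
apply/seteqP; split=> a.
  move=> [[a0 ha] [a' [r [taa' ea r1]]]]; split; last first.
    exists r => //; exact/(similitude_transpose B_nondeg (a := a : E) r taa').
  exists ((a^-1)%VF : E); split; [exact: lker0_compfV|exact: lker0_compVf|].
  move=> v; have [|w _ hw] := ha (gamma (iota v)); first by exists v.
  exists w; rewrite !gE.
  have -> : (gamma (iota w) : E) = (a : E) * (gamma (iota v) : E) * ((a^-1)%VF : E) by [].
  by rewrite -mulrA [_ * (a : E)]lker0_compVf // mulr1.
move=> [[a' [aa' a'a ha]] [r r1 hr]]; split.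
  split; first exact: endo_lker0 a'a.
  move=> _ [v _ <-]; have [w hw] := ha v; exists w => //=.
  rewrite -gE -[LHS](mulr1 (_ : E)) -aa' mulrA -hw gE.
  by rewrite (endo_inv a'a).
have r0 : r != 0 by rewrite -normr_eq0 r1 oner_eq0.
exists (r *: a'), r; split=> //.
  move=> x y; rewrite scale_lfunE pairingZr -hr.
  by rewrite -(endo_mul_app a a' y) aa' lfunE.
by rewrite -comp_lfunZl; congr (_ *: _).
Qed.

End Bridge.

(** The real numbers contain no square root of [-1].  The quaternions are
    excluded because [c], a conjugation by hypothesis, is multiplicative, while
    quaternionic conjugation reverses products.  In the complex numbers [J] is
    [i] or [-i]. *)
Lemma complex_schur_algebra (R : realType) (V : vectType R) (C : algType R)
    (iota : {linear V -> C}) (S : vectType R) (S_proper : (0 < dim S)%N)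
    (gamma : {linear C -> 'End(S)}) (g : {lrmorphism C -> endo_alg S_proper})
    (c : 'End(S) -> 'End(S)) (J u u' : endo_alg S_proper) :
  (forall x, g x = gamma x) -> schur_conjugation iota gamma c ->
  commuting iota g J -> J * J = -1 -> u' * u = 1 ->
  (forall s : endo_alg S_proper, commuting iota g s ->
     c s = u * s * u' :> endo_alg S_proper) ->
  forall s, commuting iota g s -> exists x y : R, s = x%:A + y *: J.
Proof.
move=> gE hc Jcom JJ Vu uc s hs; case: hc => -[f hf cf].
- have [f1 _ _ _ fsurj] := schur_iso_algebra gE hf.
  have [x ex] := fsurj s hs; exists x, 0; rewrite scale0r addr0 ex.
  have ex' : x = x *: (1 : R^o) :> R^o := esym (mulr1 (x : R)).
  by rewrite {1}ex' linearZ f1.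
- have [f1 fM finj fcom fsurj] := schur_iso_algebra gE hf.
  have [z ez] := fsurj J Jcom; have [w ew] := fsurj s hs.
  have zz : z * z = -1 by apply: finj; rewrite fM -ez JJ linearN f1.
  case: z w ez ew zz => x y [w1 w2] ez ew zz.
  have rez := congr1 (@complex.Re R) zz; have imz := congr1 (@complex.Im R) zz.
  rewrite /= in rez imz.
  have y0 : y != 0.
    apply/eqP => y0; have := sqr_ge0 x; rewrite expr2.
    by move: rez; rewrite y0; lra.
  have x0 : x = 0.
    apply/eqP; have : x * y == 0 by apply/eqP; lra.
    by rewrite mulf_eq0 (negbTE y0) orbF.
  have yy : y * y = 1 by move: rez; rewrite x0; lra.
  exists w1, (w2 * y); rewrite ez ew -f1 -!linearZ -linearD; congr (f _).
  apply/eqP; rewrite eq_complex /= x0.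
  by apply/andP; split; apply/eqP; [ring | rewrite -mulrA yy; ring].
have [f1 fM finj fcom fsurj] := schur_iso_algebra gE hf.
pose i : quat R := Quat 0 1 0 0; pose j : quat R := Quat 0 0 1 0.
have cM : c (f (i * j)) = (c (f i) : endo_alg S_proper) * c (f j)
  :> endo_alg S_proper.
  rewrite !uc // fM; rewrite !mulrA; congr (_ * _ * _).
  by rewrite -(mulrA _ u') Vu mulr1.
have : conjq (i * j) = conjq i * conjq j by apply: finj; rewrite fM -!cf.
move/(congr1 (@qk R)); rewrite /i /j /= => ij; exfalso; clear -ij.
have : (1 : R) = -1 by lra.
by move=> /eqP; rewrite -subr_eq0 opprK -mulr2n pnatr_eq0.
Qed.

Lemma alpha_sqr (R : realType) p q : alpha R p q * alpha R p q = 1.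
Proof.
rewrite /alpha; case: (_ %/ _)%Z => m; rewrite ?NegzE -?exprnN.
  by rewrite -exprnP -expr2 sqrr_sign.
by rewrite -invfM -expr2 sqrr_sign invr1.
Qed.

Theorem theorem5p16 (R : realType) (V : vectType R) (h : {symmetric V})
    (p q : nat) (Cl : algType R) (iota : {linear V -> Cl})
    (S : vectType R) (gamma : {linear Cl -> 'End(S)})
    (c : 'End(S) -> 'End(S)) (eps : bool)
    (Be : {hermitian S for eps & idfun})
    (hV : quadratic_space h p q)
    (hCl : is_clifford_algebra h iota)
    (hgamma : irreducible_representation gamma)
    (hc : schur_conjugation iota gamma c)
    (hBe : canonical_pairing p q iota gamma c Be) :
  let L := reduced_lipschitz_group iota gamma Be in
  let compE := @comp_lfun R S S S in
  let idE : 'End(S) := \1%VF in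
  [/\ residue p q \in [:: 0; 2] ->
        group_iso *%R 1 (Pin h iota) compE idE L gamma,
      residue p q \in [:: 3; 7] ->
        forall (Cl2 : algType R) (iota2 : {linear 'rV[R]_2 -> Cl2}),
        is_clifford_algebra (form2 (alpha R p q)) iota2 ->
        let e1 := iota2 (delta_mx 0 0) in
        let e2 := iota2 (delta_mx 0 1) in
        forall (b : (p + q).-tuple V) (u : 'End(S)),
        orthonormal_basis h b ->
        anticommutant_basis p q iota gamma c u ->
        let J := gamma (volume iota b) in
        exists phi : set (Cl * Cl2) -> 'End(S),
          (forall x (theta : R) (kappa : bool), Spin h iota x ->
             phi (pmcoset (x, expA *%R 1 (theta *: (e1 * e2)) * e1 ^+ kappa)) =
             (gamma x \o expA compE idE (theta *: J) \o
                (if kappa then u else idE))%VF) /\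
          group_iso (@mulset _) (pmcoset 1)
            (dotgroup (Spin h iota) (Pin (form2 (alpha R p q)) iota2))
            compE idE L phi,
      residue p q \in [:: 4; 6] ->
        forall f : {linear quat R -> 'End(S)},
        normed_schur_iso iota gamma c f ->
        exists phi : set (Cl * quat R) -> 'End(S),
          (forall x y, Pin h iota x -> Sp1 y ->
             phi (pmcoset (x, y)) = (gamma x \o f y)%VF) /\
          group_iso (@mulset _) (pmcoset 1) (dotgroup (Pin h iota) (@Sp1 R))
            compE idE L phi,
      residue p q = 1 ->
        group_iso *%R 1 (Spin h iota) compE idE L gamma &
      residue p q = 5 ->
        forall f : {linear quat R -> 'End(S)},
        normed_schur_iso iota gamma c f ->
        exists phi : set (Cl * quat R) -> 'End(S),
          (forall x y, Spin h iota x -> Sp1 y ->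
             phi (pmcoset (x, y)) = (gamma x \o f y)%VF) /\
          group_iso (@mulset _) (pmcoset 1) (dotgroup (Spin h iota) (@Sp1 R))
            compE idE L phi].
Proof.
move=> L compE idE.
have [n_gt0 _ [e [he hp hq]]] := hV.
have [gamma1 gammaM S_neq0 irr] := hgamma.
have [[B_nondeg adapted] ct cu] := hBe.
have S_proper : (0 < dim S)%N by rewrite -dimvf lt0n dimv_eq0.
pose E := endo_alg S_proper.
pose gammaE : Cl -> E := gamma.
have gL : linear gammaE by move=> k x y; apply: linearP.
have gM : monoid_morphism gammaE by split.
pose g : {lrmorphism Cl -> E} := HB.pack gammaE
  (GRing.isLinear.Build R Cl E *:%R gammaE gL)
  (GRing.isMonoidMorphism.Build Cl E gammaE gM).
have gE x : g x = gamma x by [].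
have B_adapted v : is_transpose Be (g (iota v))
    ((-1) ^+ canonical_type p q *: g (iota v)).
  by apply: adapted; exists v.
have LE : L = reduced iota g Be := reduced_lipschitz_groupE iota gE B_nondeg.
have schur_real k : residue p q = k%:Z -> (k < 3)%N ->
    forall s : E, commuting iota g s -> exists x : R, s = x%:A.
  move=> hk k3 s hs; case: hc => -[f hf _].
  - have [_ _ _ _ fsurj] := schur_iso_algebra gE hf.
    have [x ->] := fsurj s hs; exists x; have [f1 _ _] := hf.
    have ex : x = x *: (1 : R^o) :> R^o := esym (mulr1 (x : R)).
    by rewrite {1}ex linearZ f1.
  - by case: (schur_not_complex hCl he hp hq hk k3 (schur_iso_algebra gE hf)).
  by case: (schur_not_quat hCl he hp hq hk k3 (schur_iso_algebra gE hf)).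
have nu_sqr k : residue p q = k%:Z -> odd k ->
    volume iota e * volume iota e = ((-1) ^+ k./2)%:A.
  by move=> hk ok; rewrite (volume_sqr hCl he hq) (volume_sign R hk ok).
have nu_split k : residue p q = k%:Z -> odd k -> ~~ odd k./2 ->
    g (volume iota e) = 1 \/ g (volume iota e) = -1.
  move=> hk ok ek; apply: (central_involution (g := g)) => //.
    by rewrite -rmorphM (nu_sqr k hk ok) -signr_odd (negbTE ek) scale1r rmorph1.
  by move=> x; rewrite -!rmorphM /= (volume_central hCl he) // (residue_parity hk).
have quat_facts (f : {linear quat R -> 'End(S)}) : normed_schur_iso iota gamma c f ->
    [/\ algebra_iso iota g f,
        forall x, (c (f x) : E) * f x = (sqnormq x)%:A &
        forall x, is_transpose Be (f x) (c (f x))].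
  move=> [hf nf]; split; first exact: schur_iso_algebra.
    by move=> x; rewrite -normq_sqr; apply: nf.
  move=> x; apply: ct; apply/(schur_algebraE iota gE).
  by have [_ _ _ + _] := schur_iso_algebra gE hf; apply.
rewrite LE; split.
- move=> hr; have [k hk [k3 ek]] : exists2 k : nat, residue p q = k%:Z &
      (k < 3)%N /\ ~~ odd k.
    by move: hr; rewrite !inE => /orP[]/eqP ->; [exists 0|exists 2].
  have ev : ~~ odd (p + q) by rewrite (residue_parity hk).
  apply: (real_iso hCl he B_nondeg B_adapted (schur_real k hk k3)).
  + exact: Pin_group.
  + by [].
  + by move=> x; apply: (PinN hCl he).
  + by move=> a; apply: (reduced_split_even hCl he n_gt0 B_nondeg B_adapted ev).
  by move=> x; apply: (Pin_kernel hCl he n_gt0 B_nondeg B_adapted ev).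
- move=> hr Cl2 iota2 hC2 e1 e2 b u hb hu J.
  have [k hk [ok ek]] : exists2 k : nat, residue p q = k%:Z & odd k /\ odd k./2.
    by move: hr; rewrite !inE => /orP[]/eqP ->; [exists 3|exists 7].
  have on : odd (p + q) by rewrite (residue_parity hk).
  have e_sqr : volume iota e * volume iota e = -1.
    by rewrite (nu_sqr k) // -signr_odd ek scaleN1r.
  have b_sqr : volume iota b * volume iota b = -1.
    by rewrite (volume_sqr_indep hCl he hb).
  have [u_anti u_span uu uc] := hu.
  pose uE : E := u; pose JE : E := g (volume iota b).
  have aa := alpha_sqr R p q.
  have uuE : uE * uE = (alpha R p q)%:A := uu.
  have JJ : JE * JE = -1 by rewrite -rmorphM b_sqr rmorphN1.
  have u_antiE v : uE * g (iota v) = - (g (iota v) * uE).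
    by apply: u_anti; exists v.
  have Jcom : commuting iota g JE by apply: (volume_commuting hCl hb).
  have uJ := uJ_anti h b on u_antiE : uE * JE = - (JE * uE).
  have [uV Vu] := u_inv aa uuE.
  have u_invE : (u^-1)%VF = alpha R p q *: uE := endo_inv Vu.
  have ucE (s : E) : commuting iota g s -> c s = uE * s * (alpha R p q *: uE) :> E.
    move=> hs; rewrite -(uc s); first by rewrite -u_invE.
    exact/(schur_algebraE iota gE).
  have cJ : c JE = - JE :> E.
    by rewrite ucE // uJ mulNr -mulrA uV mulr1.
  have schur_complex := complex_schur_algebra gE hc Jcom JJ Vu ucE.
  have anti_spanE (s : E) : (forall v, s * g (iota v) = - (g (iota v) * s)) ->
      exists2 t, commuting iota g t & s = t * uE.
    move=> hs; have [|t [[ht et] _]] := u_span s.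
      by move=> _ [v _ <-]; apply: hs.
    by exists t => //; apply/(schur_algebraE iota gE).
  have u_sim : similitude Be uE 1.
    apply/(similitude_transpose B_nondeg (a' := alpha R p q *: uE)).
      by rewrite -u_invE; apply: cu.
    by rewrite Vu scale1r.
  have J_transpose : is_transpose Be JE (- JE).
    by rewrite -cJ; apply: ct; apply/(schur_algebraE iota gE).
  exact: (Spin_o_iso hCl hb n_gt0 on B_nondeg B_adapted aa uuE JJ u_antiE
    schur_complex anti_spanE u_sim J_transpose hC2).
- move=> hr f /quat_facts[hf cf tf].
  have ev : ~~ odd (p + q).
    by move: hr; rewrite !inE => /orP[]/eqP /residue_parity ->.
  have [||a|x|phi [phiE hphi]] := quat_dot_iso hCl he B_nondeg B_adapted hf cf tf
    (G := Pin h iota).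
  + exact: Pin_group.
  + by [].
  + exact: (reduced_split_even hCl he n_gt0 B_nondeg B_adapted ev).
  + exact: (Pin_kernel hCl he n_gt0 B_nondeg B_adapted ev).
  by exists phi; split=> // x y _ _; rewrite phiE.
- move=> hr; have on : odd (p + q) by rewrite (residue_parity hr).
  apply: (real_iso hCl he B_nondeg B_adapted (schur_real 1 hr isT)).
  + exact: Spin_group.
  + by move=> x [].
  + by move=> x; apply: (SpinN hCl he).
  + move=> a; apply: (reduced_split_odd hCl he B_nondeg B_adapted on).
    exact: (nu_split 1).
  by move=> x; apply: (Spin_kernel hCl he n_gt0 B_nondeg B_adapted).
move=> hr f /quat_facts[hf cf tf].
have on : odd (p + q) by rewrite (residue_parity hr).
have [||a|x|phi [phiE hphi]] := quat_dot_iso hCl he B_nondeg B_adapted hf cf tf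
  (G := Spin h iota).
+ exact: Spin_group.
+ by move=> x [].
+ exact: (reduced_split_odd hCl he B_nondeg B_adapted on (nu_split 5 hr _ _)).
+ exact: (Spin_kernel hCl he n_gt0 B_nondeg B_adapted).
by exists phi; split=> // x y _ _; rewrite phiE.
Qed.
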